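(* Let $G$ be a Lie group with finitely many components, $(\lambda,u)\in K^{2k}(G;\mathbb Z)$, and $\pi:(P,\theta)\to X$ a principal $G$-bundle with connection. The differential cohomology group $\widehat H^{2k-1}(X;\mathbb Z)$ acts on the set of all differential $u$-trivializations by $(\widehat q,h)\mapsto\widehat q+\pi^*h$. Moreover, the set of differential $u$-trivializations is a torsor for the additive group $\pi^*\widehat H^{2k-1}(X;\mathbb Z)\subset\widehat H^{2k-1}(P;\mathbb Z)$ (that is, this group acts freely and transitively on it).
   Context: Differential characters. For a smooth map $\varphi:A\to X$ of manifolds (possibly infinite-dimensional) let $C_k(\varphi;\mathbb Z)=C_k(X;\mathbb Z)\oplus C_{k-1}(A;\mathbb Z)$ (smooth singular chains), $\partial_\varphi(v,w)=(\partial v+\varphi_*w,-\partial w)$, with cycles $Z_*(\varphi;\mathbb Z)$ and cohomology $H^*(\varphi;\mathbb Z)$ (coboundary $\delta_\varphi(\mu,\nu)=(\delta\mu,\varphi^*\mu-\delta\nu)$). Let $\Omega^k(\varphi)=\Omega^k(X)\times\Omega^{k-1}(A)$. For $k\ge2$, $\widehat H^k(\varphi;\mathbb Z)$ is the abelian group (written additively) of homomorphisms $h:Z_{k-1}(\varphi;\mathbb Z)\to U(1)$ for which there is $(\omega,\vartheta)\in\Omega^k(\varphi)$ with $h(\partial_\varphi(v,w))=\exp(2\pi i(\int_v\omega+\int_w\vartheta))$ for all $(v,w)$; $\mathrm{curv}(h)=\omega$, $\mathrm{cov}(h)=\vartheta$ (unique). $c(h)\in H^k(\varphi;\mathbb Z)$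 is the class of $(v,w)\mapsto\int_v\omega+\int_w\vartheta-\tilde h(\partial_\varphi(v,w))$, $\tilde h:Z_{k-1}(\varphi;\mathbb Z)\to\mathbb R$ a homomorphism with $h=\exp(2\pi i\tilde h)$. Dropping $A$ gives absolute groups $\widehat H^k(X;\mathbb Z)$; $\widehat H^1(X;\mathbb Z)=C^\infty(X,U(1))$. Maps: $\iota_\varphi(\mu,\nu)(s,t)=\exp(2\pi i(\int_s\mu+\int_t\nu))$ for $(\mu,\nu)\in\Omega^{k-1}(\varphi)$; $\breve\imath_\varphi:\widehat H^{k-1}(A;\mathbb Z)\to\widehat H^k(\varphi;\mathbb Z)$, $\breve\imath_\varphi(h)(s,t)=h(t)$; $\breve p_\varphi(h)(z)=h(z,0)\in\widehat H^k(X;\mathbb Z)$. Chern–Weil data. $I^k(G)$: symmetric multilinear $\mathrm{Ad}_G$-invariant maps $\lambda:\mathfrak g^{\otimes k}\to\mathbb R$. $\pi_{EG}:EG\to BG$ is a universal principal $G$-bundle ($EG$ contractible, with smooth structure) with fixed universal connection $\Theta$: every $(P,\theta)\to X$ is $f^*(EG,\Theta)$ for some smooth classifying map $f$. $CW_\theta(\lambda)=\lambda(F_\theta^k)$. $CS_\theta(\lambda)=\int_0^1\iota_{\partial_t}CW_{\tilde\theta}(\lambda)dt\in\Omega^{2k-1}(P)$ with $\tilde\theta=(1-t)\theta_{\mathrm{taut}}+t\,\pi^*\theta$ on $\pi^*P\times[0,1]\to P\times[0,1]$, $\theta_{\mathrm{taut}}$ the flat connection on $\pi^*P\to P$ for which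 the tautological section is parallel. $K^{2k}(G;\mathbb Z)=\{(\lambda,u)\in I^k(G)\times H^{2k}(BG;\mathbb Z):[CW_\Theta(\lambda)]_{dR}=u_{\mathbb R}\}$; $u(P)=f^*u$. $\widehat{CW}_\theta(\lambda,u)\in\widehat H^{2k}(X;\mathbb Z)$ is the unique natural character with curvature $CW_\theta(\lambda)$ and characteristic class $u(P)$. $\widehat{CCS}_\theta(\lambda,u)\in\widehat H^{2k}(\pi;\mathbb Z)$ is the unique relative character, natural under pull-back of bundles with connection, with $\mathrm{curv}=CW_\theta(\lambda)$, $\mathrm{cov}=CS_\theta(\lambda)$ and $\breve p_\pi(\widehat{CCS}_\theta(\lambda,u))=\widehat{CW}_\theta(\lambda,u)$; it is the pull-back along a classifying map of the unique character on $\pi_{EG}$ with curvature $CW_\Theta(\lambda)$, covariant derivative $CS_\Theta(\lambda)$ and characteristic class the preimage of $u$ under the isomorphism $H^{2k}(\pi_{EG};\mathbb Z)\cong H^{2k}(BG;\mathbb Z)$. A differential $u$-trivialization is $\widehat q\in\widehat H^{2k-1}(P;\mathbb Z)$ such that $-\breve\imath_\pi(\widehat q)=\widehat{CCS}_\theta(\lambda,u)-\iota_\pi(\varrho,0)$ for some $\varrho\in\Omega^{2k-1}(X)$. The set of these may be empty (it is non-empty iff $u(P)=0$); the torsor statement is vacuous in that case. *)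

(* Defs.v *)
From HB Require Import structures.
From mathcomp Require Import all_boot all_order all_algebra perm.
From mathcomp Require Import all_classical all_reals all_analysis.
From mathcomp Require Import complex zify.
From mathcomp Require Import freeg.

Set Implicit Arguments.
Unset Strict Implicit.
Unset Printing Implicit Defensive.

Import numFieldNormedType.Exports.
Import Order.TTheory GRing.Theory Num.Theory.
Local Open Scope classical_set_scope.
Local Open Scope ring_scope.

(* Manifolds, finite or infinite dimensional, are handled through their smooth
   maps from the Euclidean spaces R^m ("plots"): a space is a diffeology, and a
   manifold is a space that has charts.  Finite-dimensional, Frechet and
   convenient manifolds embed fully faithfully in diffeological spaces, and on
   them the notions below (smooth maps, differential forms, smooth simplices)
   are the usual ones.

   Degrees.  All cohomological degrees n are the usual ones, and n.-1, n.-1.-1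
   are n-1, n-2; relative objects are only meaningful for n > 0. *)

Section Smooth.
Context {R : realType}.

(* times_diff k f: all iterated directional derivatives of f of order < k exist
   and are Frechet differentiable.  Hence smooth f is C^infinity. *)
Fixpoint times_diff (k m : nat) (W : normedModType R)
    (f : 'rV[R]_m -> W) : Prop :=
  if k is k'.+1 then
    (forall x, differentiable f x) /\
    (forall v, times_diff k' (fun x => 'D_v f x))
  else True.

Definition smooth m (W : normedModType R) (f : 'rV[R]_m -> W) : Prop :=
  forall k, times_diff k f.

Lemma smooth_diff m (W : normedModType R) (f : 'rV[R]_m -> W) x :
  smooth f -> differentiable f x.
Proof. by move=> /(_ 1%N) []. Qed.

Lemma times_diffW k m (W : normedModType R) (f : 'rV[R]_m -> W) :
  times_diff k.+1 f -> times_diff k f.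
Proof.
elim: k f => [//|k IH] f [df dDf]; split=> // v; apply: IH; exact: dDf.
Qed.

Lemma times_diff_cst k m (W : normedModType R) (w : W) :
  times_diff k (fun _ : 'rV[R]_m => w).
Proof.
elim: k w => [//|k IH] w; split=> [x|v]; first exact: differentiable_cst.
under eq_fun do rewrite derive_cst; exact: IH.
Qed.

Lemma times_diffD k m (W : normedModType R) (f g : 'rV[R]_m -> W) :
  times_diff k f -> times_diff k g -> times_diff k (fun x => f x + g x).
Proof.
elim: k f g => [//|k IH] f g [df dDf] [dg dDg]; split=> [x|v].
  exact: differentiableD.
rewrite (_ : (fun x => _) = fun x => 'D_v f x + 'D_v g x).
  by apply: IH; [exact: dDf|exact: dDg].
by apply/funext => x; rewrite deriveD//; exact: diff_derivable.
Qed.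

Lemma times_diffM k m (f g : 'rV[R]_m -> R) :
  times_diff k f -> times_diff k g -> times_diff k (fun x => f x * g x).
Proof.
elim: k f g => [//|k IH] f g Hf Hg; split=> [x|v].
  by apply: differentiableM; [case: Hf|case: Hg].
have [[df dDf] [dg dDg]] := (Hf, Hg).
rewrite (_ : (fun x => _) = fun x => f x * 'D_v g x + g x * 'D_v f x).
  by apply: times_diffD; apply: IH; [exact: times_diffW|apply: dDg|exact: times_diffW|apply: dDf].
apply/funext => x; have -> : (fun x => f x * g x) = f * g by [].
by rewrite deriveM//; exact: diff_derivable.
Qed.

Lemma times_diff_linear k m (V W : normedModType R) (l : {linear V -> W})
    (f : 'rV[R]_m -> V) :
  continuous l -> times_diff k f -> times_diff k (fun x => l (f x)).
Proof.
move=> cl; elim: k f => [//|k IH] f [df dDf]; split=> [x|v].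
  by apply: (differentiable_comp (df x)); exact: linear_differentiable.
rewrite (_ : (fun x => _) = fun x => l ('D_v f x)); first by apply: IH; exact: dDf.
apply/funext => x; rewrite !deriveE//.
  have -> : (fun x => l (f x)) = l \o f by [].
  by rewrite diff_comp ?diff_lin//; exact: linear_differentiable.
by apply: (differentiable_comp (df x)); exact: linear_differentiable.
Qed.

Lemma times_diff_sum k m (W : normedModType R) (I : Type) (r : seq I)
    (f : I -> 'rV[R]_m -> W) :
  (forall i, times_diff k (f i)) ->
  times_diff k (fun x => \sum_(i <- r) f i x).
Proof.
move=> Hf; elim: r => [|i r IH].
  by under eq_fun do rewrite big_nil; exact: times_diff_cst.
by under eq_fun do rewrite big_cons; apply: times_diffD.
Qed.

Fact coord_is_linear n (i : 'I_n) :
  linear (fun v : 'rV[R]_n => v 0 i : R^o).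
Proof. by move=> a u v; rewrite !mxE. Qed.

Lemma times_diff_coord k m n (f : 'rV[R]_m -> 'rV[R]_n) i :
  times_diff k f -> times_diff k (fun x => f x 0 i).
Proof.
pose lM := GRing.isLinear.Build _ _ _ _ _ (coord_is_linear i).
pose l : {linear 'rV[R]_n -> R^o} := HB.pack (fun v : 'rV[R]_n => v 0 i : R^o) lM.
by apply: (@times_diff_linear k m _ R^o l); exact: coord_continuous.
Qed.

Fact line_is_linear (W : normedModType R) (w : W) :
  linear (fun a : R^o => a *: w).
Proof. by move=> a u v; rewrite scalerDl scalerA. Qed.

Lemma times_diffZ k m (W : normedModType R) (f : 'rV[R]_m -> R) (w : W) :
  times_diff k f -> times_diff k (fun x => f x *: w).
Proof.
pose lM := GRing.isLinear.Build _ _ _ _ _ (line_is_linear w).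
pose l : {linear R^o -> W} := HB.pack (fun a : R^o => a *: w) lM.
apply: (@times_diff_linear k m R^o _ l); exact: scalel_continuous.
Qed.

Lemma times_diff_row k m n (f : 'rV[R]_m -> 'rV[R]_n) :
  (forall i, times_diff k (fun x => f x 0 i)) -> times_diff k f.
Proof.
move=> Hf.
rewrite (_ : f = fun x => \sum_i f x 0 i *: (delta_mx 0 i : 'rV_n)).
  by apply: times_diff_sum => i; exact: times_diffZ.
by apply/funext => x; rewrite -row_sum_delta.
Qed.

Lemma smooth_row m n (f : 'rV[R]_m -> 'rV[R]_n) :
  (forall i, smooth (fun x => f x 0 i)) -> smooth f.
Proof. by move=> Hf k; apply: times_diff_row => i; exact: Hf. Qed.

Lemma smooth_id m : smooth (@id 'rV[R]_m).
Proof.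
have did (x : 'rV[R]_m) : differentiable id x by exact: ex_diff.
case=> [//|k]; split=> [//|v].
rewrite (_ : (fun x => _) = fun=> v); first exact: times_diff_cst.
by apply/funext => x; rewrite deriveE ?diff_val.
Qed.

Lemma smooth_coord m (i : 'I_m) : smooth (fun x : 'rV[R]_m => x 0 i).
Proof. by move=> k; apply: times_diff_coord; exact: smooth_id. Qed.

Lemma smooth_cst m (W : normedModType R) (w : W) :
  smooth (fun _ : 'rV[R]_m => w).
Proof. by move=> k; exact: times_diff_cst. Qed.

Lemma derive_coord m n (g : 'rV[R]_m -> 'rV[R]_n) x v i :
  differentiable g x -> ('D_v g x) 0 i = 'D_v (fun y => g y 0 i) x.
Proof. by move=> dg; rewrite derive_mx ?mxE//; exact: diff_derivable. Qed.

Definition scalar_action (W : normedModType R) (a : R^o) (w : W) : W := a *: w.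

Fact scale_fun_bilinear (W : normedModType R) :
  bilinear_for (GRing.Scale.Law.clone _ _ *:%R _)
    (GRing.Scale.Law.clone _ _ *:%R _) (@scalar_action W).
Proof.
split=> [w|a] b x y; rewrite /scalar_action /=; first by rewrite scalerDl scalerA.
by rewrite scalerDr !scalerA mulrC.
Qed.

HB.instance Definition _ (W : normedModType R) :=
  bilinear_isBilinear.Build R R^o W W _ _ (@scalar_action W)
    (scale_fun_bilinear W).

Lemma times_diffMZ k m (W : normedModType R) (f : 'rV[R]_m -> R)
    (g : 'rV[R]_m -> W) :
  times_diff k f -> times_diff k g -> times_diff k (fun x => f x *: g x).
Proof.
elim: k f g => [//|k IH] f g Hf Hg.
have cs : continuous (fun p : R^o * W => p.1 *: p.2) by exact: scale_continuous.
have sE : (fun x => f x *: g x) = (fun p : R^o * W => p.1 *: p.2) \o (fun x => (f x : R^o, g x)) by [].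
have dfg x : differentiable (fun x => (f x : R^o, g x)) x.
  by apply: differentiable_pair; [case: Hf|case: Hg].
have ds p : differentiable (fun p : R^o * W => p.1 *: p.2) p.
  exact: (@differentiable_bilin R R^o W W (@scalar_action W : {bilinear R^o -> W -> W}) p cs).
split=> [x|v]; first by rewrite sE; exact: differentiable_comp.
have [[df dDf] [dg dDg]] := (Hf, Hg).
rewrite (_ : (fun x => _) = fun x => f x *: 'D_v g x + 'D_v f x *: g x).
  by apply: times_diffD; apply: IH; [exact: times_diffW|apply: dDg|apply: dDf|exact: times_diffW].
apply/funext => x; rewrite sE deriveE; last exact: differentiable_comp.
rewrite diff_comp//= (@diff_bilin R R^o W W (@scalar_action W : {bilinear R^o -> W -> W}) _ cs)//=.
by rewrite /scalar_action diff_pair//= !deriveE.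
Qed.

Lemma smooth_comp l m (W : normedModType R) (f : 'rV[R]_m -> W)
    (g : 'rV[R]_l -> 'rV[R]_m) : smooth f -> smooth g -> smooth (f \o g).
Proof.
move=> sf sg k.
elim: k f sf => [//|k IH] f sf; split=> [x|v].
  by apply: differentiable_comp; exact: smooth_diff.
rewrite (_ : (fun x => _) = fun x =>
    \sum_i ('D_v g x) 0 i *: 'D_(delta_mx 0 i) f (g x)).
  apply: times_diff_sum => i; apply: times_diffMZ.
    by apply: times_diff_coord; have [_] := sg k.+1; apply.
  apply: (IH (fun y => 'D_(delta_mx 0 i) f y)) => j.
  by have [_] := sf j.+1; apply.
apply/funext => x; have [df dg] := (smooth_diff (g x) sf, smooth_diff x sg).
rewrite deriveE; last exact: differentiable_comp.
rewrite diff_comp//= (deriveE v dg).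
transitivity ('d f (g x) (\sum_i ('d g x v) 0 i *: delta_mx 0 i)).
  by rewrite -row_sum_delta.
by rewrite linear_sum; apply: eq_bigr => i _; rewrite linearZ/= deriveE.
Qed.

Lemma eq_near_differentiable (V W : normedModType R) (f g : V -> W) x :
  (\near x, f x = g x) -> differentiable f x -> differentiable g x.
Proof.
move=> fg df; pose h := g - f.
have h0 : \near x, h x = 0.
  by apply: filterS fg => y fgy; rewrite /h !fctE fgy subrr.
have hx : h x = 0 by exact: nbhs_singleton h0.
have hs : \forall y \near (0 : V), h (y + x) = 0.
  have /(_ _ h0) : (y + x) @[y --> (0 : V)] --> x.
    by rewrite -{2}[x]add0r; apply: cvgD; [exact: cvg_id|exact: cvg_cst].
  by [].
have e0 : h \o shift x = cst (h x) + \0 +o_ 0 id.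
  rewrite eqaddoP => e e0; apply: filterS hs => y hy.
  rewrite !fctE /= /shift hy hx addr0 subrr normr0 mulr_ge0// ltW//.
have dh : differentiable h x.
  by apply/diff_locallyP; rewrite (@diff_unique _ _ _ _ \0 _ (@cst_continuous _ _ _) e0); split=> //; exact: cst_continuous.
have -> : g = f + h by rewrite /h addrC subrK.
exact: (@differentiableD _ _ _ f h x df dh).
Qed.

Lemma times_diff_local k m (W : normedModType R) (f : 'rV[R]_m -> W) :
  (forall x : 'rV[R]_m, exists2 g, times_diff k g & \forall y \near x, f y = g y) ->
  times_diff k f.
Proof.
elim: k f => [//|k IH] f Hf; split=> [x|v].
  have [g [dg _] fg] := Hf x; apply: eq_near_differentiable (dg x).
  by apply: filterS fg => y ->.
apply: IH => x; have [g [_ dDg] fg] := Hf x.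
exists (fun x => 'D_v g x); first exact: dDg.
near=> y; apply: near_eq_derive; near: y; exact: (nbhs_interior fg).
Unshelve. all: by end_near. Qed.

End Smooth.

Section Spaces.
Context {R : realType}.

(* Only plots defined on a whole R^m are recorded.  This loses nothing: every
   point of an open set U of R^m has a neighbourhood in U on which the identity
   coincides with a smooth map R^m -> U, so plots on U are the maps that
   coincide near each point with a global plot. *)
Record diffeology (T : Type) := Diffeology {
  is_plot : forall m, ('rV[R]_m -> T) -> Prop;
  is_plot_cst : forall m (a : T), is_plot (fun _ : 'rV[R]_m => a);
  is_plot_comp : forall l m (p : 'rV[R]_m -> T) (g : 'rV[R]_l -> 'rV[R]_m),
    is_plot p -> smooth g -> is_plot (p \o g);
  is_plot_local : forall m (p : 'rV[R]_m -> T),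
    (forall x : 'rV[R]_m, exists2 q, is_plot q & \forall y \near x, p y = q y) ->
    is_plot p
}.

Record smoothSpace := Space { carrier :> Type; space_diff : diffeology carrier }.

Record plot (X : smoothSpace) m := Plot {
  plot_fun :> 'rV[R]_m -> X;
  plotP : is_plot (space_diff X) plot_fun
}.

Definition plot_comp (X : smoothSpace) l m (p : plot X m)
    (g : 'rV[R]_l -> 'rV[R]_m) (sg : smooth g) : plot X l :=
  Plot (is_plot_comp (plotP p) sg).

Definition plot_cst (X : smoothSpace) m (a : X) : plot X m :=
  Plot (is_plot_cst (space_diff X) m a).

Record smap (X Y : smoothSpace) := SMap {
  smap_fun :> X -> Y;
  smapP : forall m (p : plot X m), is_plot (space_diff Y) (smap_fun \o p)
}.

Definition smap_plot (X Y : smoothSpace) (f : smap X Y) m (p : plot X m) : plot Y m :=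
  Plot (smapP f p).

Definition smap_comp (X Y Z : smoothSpace) (g : smap Y Z) (f : smap X Y) : smap X Z :=
  @SMap X Z (g \o f) (fun m p => smapP g (smap_plot f p)).

Section Line.
Let sm m (p : 'rV[R]_m -> R) : Prop := smooth p.

Fact line_cst m (a : R) : sm (fun _ : 'rV[R]_m => a).
Proof. exact: smooth_cst. Qed.

Fact line_comp l m (p : 'rV[R]_m -> R) (g : 'rV[R]_l -> 'rV[R]_m) :
  sm p -> smooth g -> sm (p \o g).
Proof. exact: smooth_comp. Qed.

Fact line_local m (p : 'rV[R]_m -> R) :
  (forall x : 'rV[R]_m, exists2 q, sm q & \forall y \near x, p y = q y) -> sm p.
Proof.
move=> H k; apply: times_diff_local => x; have [q sq pq] := H x.
by exists q; [exact: sq|exact: pq].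
Qed.

Definition real_line : smoothSpace := Space (Diffeology line_cst line_comp line_local).
End Line.

Section Product.
Variables X Y : smoothSpace.
Let pl m (p : 'rV[R]_m -> X * Y) : Prop :=
  is_plot (space_diff X) (fst \o p) /\ is_plot (space_diff Y) (snd \o p).

Fact prod_cst m (a : X * Y) : pl (fun _ : 'rV[R]_m => a).
Proof. by split; exact: is_plot_cst. Qed.

Fact prod_comp l m (p : 'rV[R]_m -> X * Y) (g : 'rV[R]_l -> 'rV[R]_m) :
  pl p -> smooth g -> pl (p \o g).
Proof.
by move=> [p1 p2] sg; split; [exact: (is_plot_comp p1)|exact: (is_plot_comp p2)].
Qed.

Fact prod_local m (p : 'rV[R]_m -> X * Y) :
  (forall x : 'rV[R]_m, exists2 q, pl q & \forall y \near x, p y = q y) -> pl p.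
Proof.
move=> H; split; apply: is_plot_local => x; have [q [q1 q2] pq] := H x.
  by exists (fst \o q) => //; apply: filterS pq => y /= ->.
by exists (snd \o q) => //; apply: filterS pq => y /= ->.
Qed.

Definition prod_space : smoothSpace := Space (Diffeology prod_cst prod_comp prod_local).
End Product.

Section Subspace.
Variables (X : smoothSpace) (A : set X).
Let pl m (p : 'rV[R]_m -> {x : X | A x}) : Prop :=
  is_plot (space_diff X) (fun y => sval (p y)).

Fact sub_cst m (a : {x : X | A x}) : pl (fun _ : 'rV[R]_m => a).
Proof. exact: is_plot_cst. Qed.

Fact sub_comp l m (p : 'rV[R]_m -> {x : X | A x}) (g : 'rV[R]_l -> 'rV[R]_m) :
  pl p -> smooth g -> pl (p \o g).
Proof. exact: is_plot_comp. Qed.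

Fact sub_local m (p : 'rV[R]_m -> {x : X | A x}) :
  (forall x : 'rV[R]_m, exists2 q, pl q & \forall y \near x, p y = q y) -> pl p.
Proof.
move=> H; apply: is_plot_local => x; have [q pq E] := H x.
by exists (fun y => sval (q y)) => //; apply: filterS E => y /= ->.
Qed.

Definition sub_space : smoothSpace := Space (Diffeology sub_cst sub_comp sub_local).
End Subspace.

Definition fst_smap (X Y : smoothSpace) : smap (prod_space X Y) X :=
  @SMap (prod_space X Y) X fst (fun m p => proj1 (plotP p)).

(* The D-topology: on a manifold it is the manifold topology (for models that
   are not Frechet, the c^infinity-refinement of it). *)
Definition D_open (X : smoothSpace) (V : set X) : Prop :=
  forall m (p : plot X m), open (p @^-1` V).

Definition D_hausdorff (X : smoothSpace) : Prop :=
  forall x y : X, x <> y ->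
  exists U V, [/\ D_open U, D_open V, U x, V y & U `&` V = set0].

Definition D_second_countable (X : smoothSpace) : Prop :=
  exists B : nat -> set X, (forall n, D_open (B n)) /\
  (forall U x, D_open U -> U x -> exists n, B n x /\ B n `<=` U).

(* phi : V -> W and psi : W -> V are inverse diffeomorphisms; smE selects the
   smooth maps from R^m to the model E.  Values of phi off V and of psi off W
   are irrelevant. *)
Record is_chart (X : smoothSpace) (E : topologicalType)
    (smE : forall m, ('rV[R]_m -> E) -> Prop)
    (V : set X) (W : set E) (phi : X -> E) (psi : E -> X) : Prop := IsChart {
  chart_dom : D_open V;
  chart_cod : open W;
  chart_to : forall x, V x -> W (phi x);
  chart_of : forall e, W e -> V (psi e);
  chart_toK : forall x, V x -> psi (phi x) = x;
  chart_ofK : forall e, W e -> phi (psi e) = e;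
  chart_smooth : forall m (p : plot X m), (forall x, V (p x)) -> smE m (phi \o p);
  chart_inv_smooth : forall m (c : 'rV[R]_m -> E),
    smE m c -> (forall x, W (c x)) -> is_plot (space_diff X) (psi \o c)
}.

Definition finite_dim_manifold (d : nat) (X : smoothSpace) : Prop :=
  D_hausdorff X /\ forall x : X, exists V W phi psi,
    V x /\ @is_chart X 'rV[R]_d (fun m => @smooth R m 'rV[R]_d) V W phi psi.

(* Smooth maps into a complete locally convex space are the scalarwise smooth
   ones (Kriegl-Michor, The Convenient Setting, Section 2). *)
Definition lc_smooth (E : tvsType R) m (c : 'rV[R]_m -> E) : Prop :=
  forall l : {linear E -> R^o}, continuous l -> smooth (l \o c).

Definition manifold (X : smoothSpace) : Prop :=
  D_hausdorff X /\ forall x : X, exists E : tvsType R,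
    [/\ hausdorff_space E,
        forall F : set_system E, ProperFilter F -> cauchy F -> exists e : E, F --> e &
        exists V W phi psi, V x /\ @is_chart X E (@lc_smooth E) V W phi psi].

Definition contractible (X : smoothSpace) : Prop :=
  exists (H : smap (prod_space X real_line) X) (x0 : X),
    forall x, H (x, 0) = x /\ H (x, 1) = x0.

End Spaces.

Section Forms.
Context {R : realType}.
Implicit Types X Y : @smoothSpace R.

(* rform X n W is the type of raw families of W-valued functions w_p(x; v_0 .. v_(n-1))
   indexed by plots p; a differential n-form is a raw family that satisfies is_form,
   and w_p is then the pull-back p^*w written as an alternating form on R^m.
   Operations are defined on raw families so that they are total. *)
Definition rform X n (W : normedModType R) : Type :=
  forall m, plot X m -> 'rV[R]_m -> ('I_n -> 'rV[R]_m) -> W.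

Record is_form X n (W : normedModType R) (w : rform X n W) : Prop := IsForm {
  form_smooth : forall m (p : plot X m) v, smooth (fun x => w m p x v);
  form_linear : forall m (p : plot X m) x v i a u u',
    w m p x [eta v with i |-> a *: u + u'] =
    a *: w m p x [eta v with i |-> u] + w m p x [eta v with i |-> u'];
  form_alternating : forall m (p : plot X m) x v i j,
    i != j -> v i = v j -> w m p x v = 0;
  form_natural : forall l m (p : plot X m) (g : 'rV[R]_l -> 'rV[R]_m)
    (sg : smooth g) x v,
    w l (plot_comp p sg) x v = w m p (g x) (fun i => 'D_(v i) g x)
}.

Definition zero_form X n (W : normedModType R) : rform X n W :=
  fun _ _ _ _ => 0.

Definition pull_form X Y (f : smap X Y) n (W : normedModType R)
    (w : rform Y n W) : rform X n W :=
  fun m p => w m (smap_plot f p).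

Lemma smooth_lsubmx m n : smooth (fun y : 'rV[R]_(m + n) => lsubmx y).
Proof.
apply: smooth_row => i.
by under eq_fun do rewrite mxE; exact: smooth_coord.
Qed.

(* p x id : R^m x R -> X x R *)
Fact cylinder_plot_subproof X m (p : plot X m) :
  is_plot (space_diff (prod_space X real_line))
    (fun y : 'rV[R]_(m + 1) => (p (lsubmx y), rsubmx y 0 0)).
Proof.
split; first exact: (is_plot_comp (plotP p) (@smooth_lsubmx m 1)).
by rewrite /comp /=; under eq_fun do rewrite mxE; exact: smooth_coord.
Qed.

Definition cylinder_plot X m (p : plot X m) : plot (prod_space X real_line) (m + 1) :=
  Plot (cylinder_plot_subproof p).

(* int_0^1 iota_(d/dt) w dt for w on X x R: slot 0 of w receives d/dt and slot
   j + 1 receives v_j. *)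
Definition fibre_integral X n (w : rform (prod_space X real_line) n R) :
    rform X n.-1 R :=
  fun m p x v => \int[lebesgue_measure]_(t in `[0, 1])
    w (m + 1)%N (cylinder_plot p) (row_mx x t%:M)
      (fun i => if [pick j : 'I_n.-1 | j.+1 == i :> nat] is Some j
                then row_mx (v j) 0 else row_mx 0 1%:M).

End Forms.

Section Chains.
Context {R : realType}.
Implicit Types X Y A : @smoothSpace R.

Definition in_simplex n (x : 'rV[R]_n.+1) : bool :=
  [forall i, 0 <= x 0 i] && (\sum_i x 0 i == 1).

Definition std_simplex n : Type := {x : 'rV[R]_n.+1 | in_simplex x}.

Definition face_map n (i : 'I_n.+2) (x : 'rV[R]_n.+1) : 'rV[R]_n.+2 :=
  \row_j (if unlift i j is Some j' then x 0 j' else 0).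

Fact face_map_in n (i : 'I_n.+2) (x : 'rV[R]_n.+1) :
  in_simplex x -> in_simplex (face_map i x).
Proof.
case/andP => /forallP x0 /eqP x1; apply/andP; split.
  by apply/forallP => j; rewrite mxE; case: unliftP.
rewrite (bigD1 i)//= mxE unlift_none add0r; apply/eqP.
rewrite -[RHS]x1 (reindex (fintype.lift i)) /=; last first.
  exists (fun j => odflt ord0 (unlift i j)) => j; first by rewrite liftK.
  by rewrite inE => ji; case: unliftP ji => [j' ->//|->]; rewrite eqxx.
under eq_bigl do rewrite eq_sym neq_lift.
by apply: eq_bigr => j _; rewrite mxE liftK.
Qed.

Definition std_face n (i : 'I_n.+2) (x : std_simplex n) : std_simplex n.+1 :=
  exist _ (face_map i (sval x)) (face_map_in i (svalP x)).

Fact smooth_face_map n (i : 'I_n.+2) : smooth (@face_map n i).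
Proof.
apply: smooth_row => j; rewrite /face_map.
under eq_fun do rewrite mxE.
by case: unlift => [j'|]; [exact: smooth_coord|exact: smooth_cst].
Qed.

(* A smooth simplex is a map on the closed standard simplex with a smooth
   extension to the ambient Euclidean space. *)
Record simplex X n := Simplex {
  simplex_fun :> std_simplex n -> X;
  simplexP : exists p : plot X n.+1, forall x, simplex_fun x = p (sval x)
}.

Lemma simplex_eq X n (s t : simplex X n) :
  (forall x, s x = t x) -> s = t.
Proof.
case: s t => [s sp] [t tp] /= /funext st; case: t / st in tp *.
by congr Simplex; exact: Prop_irrelevance.
Qed.

HB.instance Definition _ X n := gen_eqMixin (simplex X n).
HB.instance Definition _ X n := gen_choiceMixin (simplex X n).

Fact simplex_face_subproof X n (s : simplex X n.+1) (i : 'I_n.+2) :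
  exists p : plot X n.+1, forall x, (s \o std_face i) x = p (sval x).
Proof.
have [p sp] := simplexP s; exists (plot_comp p (@smooth_face_map n i)) => x.
by rewrite /= sp.
Qed.

Definition simplex_face X n (s : simplex X n.+1) (i : 'I_n.+2) : simplex X n :=
  Simplex (simplex_face_subproof s i).

Fact push_simplex_subproof X Y (f : smap X Y) n (s : simplex X n) :
  exists p : plot Y n.+1, forall x, (f \o s) x = p (sval x).
Proof.
by have [p sp] := simplexP s; exists (smap_plot f p) => x; rewrite /= sp.
Qed.

Definition push_simplex X Y (f : smap X Y) n (s : simplex X n) : simplex Y n :=
  Simplex (push_simplex_subproof f s).

Definition schain X n : Type := {freeg (simplex X n) / int}.
HB.instance Definition _ X n := GRing.Zmodule.on (schain X n).

(* The homomorphism out of the free abelian group that extends f. *)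
Definition lin_ext X n (M : zmodType) (f : simplex X n -> M) (c : schain X n) : M :=
  fglift (f : simplex X n -> zmodule M) c.

Fact lin_ext_additive X n (M : zmodType) (f : simplex X n -> M) :
  zmod_morphism (lin_ext f).
Proof. exact: (@lift_is_additive _ _ (zmodule M)). Qed.
HB.instance Definition _ X n (M : zmodType) (f : simplex X n -> M) :=
  GRing.isZmodMorphism.Build (schain X n) M (lin_ext f) (lin_ext_additive f).

Lemma lin_extU X n (M : zmodType) (f : simplex X n -> M) s :
  lin_ext f << s >> = f s.
Proof. by rewrite /lin_ext liftU scale1r. Qed.

Lemma chainU X n (k : int) (s : simplex X n) :
  << k *g s >> = << s >> *~ k :> schain X n.
Proof. by rewrite freegU_mulz intz. Qed.

Lemma eq_additive_chain X n (M : zmodType) (F G : {additive schain X n -> M}) :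
  (forall s, F << s >> = G << s >>) -> F =1 G.
Proof.
move=> FG c; rewrite -[c](freeg_sumE) !raddf_sum; apply: eq_bigr => s _.
by rewrite chainU !raddfMz FG.
Qed.

End Chains.

Section Kernel.
Variables (U V : zmodType) (d : {additive U -> V}).

Definition in_ker : {pred U} := fun x => d x == 0.

Fact in_ker_zmod : zmod_closed in_ker.
Proof.
split; first by rewrite unfold_in raddf0.
by move=> x y; rewrite !unfold_in raddfB => /eqP-> /eqP->; rewrite subr0.
Qed.
HB.instance Definition _ := GRing.isZmodClosed.Build U in_ker in_ker_zmod.

Definition ker_of : Type := {x : U | in_ker x}.
HB.instance Definition _ := SubChoice.on ker_of.
HB.instance Definition _ := [SubChoice_isSubZmodule of ker_of by <:].

Lemma ker_ofE (z : ker_of) : d (val z) = 0.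
Proof. exact/eqP/(valP z). Qed.

Definition in_kerP x (dx : d x = 0) : ker_of := Sub x (introT eqP dx).

End Kernel.

Section Homology.
Context {R : realType}.
Implicit Types X Y A : @smoothSpace R.

(* bd is zero on 0-chains; its codomain in that case plays no role. *)
Definition bd X n : schain X n -> schain X n.-1 :=
  match n return schain X n -> schain X n.-1 with
  | 0 => fun _ => 0
  | n'.+1 => lin_ext (fun s : simplex X n'.+1 =>
      \sum_(i < n'.+2) << (-1) ^+ i *g simplex_face s i >> : schain X n')
  end.

Fact bd_additive X n : zmod_morphism (@bd X n).
Proof.
case: n => [|n] c c' /=; first by rewrite subr0.
exact: lin_ext_additive.
Qed.
HB.instance Definition _ X n :=
  GRing.isZmodMorphism.Build (schain X n) (schain X n.-1) (@bd X n)
    (@bd_additive X n).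

Definition push_chain X Y (f : smap X Y) n : schain X n -> schain Y n :=
  lin_ext (fun s => << push_simplex f s >> : schain Y n).
HB.instance Definition _ X Y (f : smap X Y) n :=
  GRing.Additive.copy (@push_chain X Y f n)
    (lin_ext (fun s => << push_simplex f s >> : schain Y n)).

Lemma push_simplex_face X Y (f : smap X Y) n (s : simplex X n.+1) i :
  push_simplex f (simplex_face s i) = simplex_face (push_simplex f s) i.
Proof.
by apply: simplex_eq. Qed.

Lemma bd_push X Y (f : smap X Y) n (c : schain X n) :
  bd (push_chain f c) = push_chain f (bd c).
Proof.
case: n c => [|n] c; first by rewrite /= raddf0.
apply: (@eq_additive_chain _ X n.+1 _ (@bd Y n.+1 \o @push_chain X Y f n.+1)
  (@push_chain X Y f n \o @bd X n.+1)) c => s /=.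
rewrite /push_chain lin_extU /= !lin_extU raddf_sum; apply: eq_bigr => i _.
rewrite -push_simplex_face [in RHS]chainU [in LHS]chainU raddfMz.
by rewrite /= /push_chain lin_extU.
Qed.

Definition cyc X n : Type := ker_of (@bd X n).
HB.instance Definition _ X n := GRing.Zmodule.on (cyc X n).

Fact push_cyc_subproof X Y (f : smap X Y) n (z : cyc X n) :
  bd (push_chain f (val z)) = 0.
Proof. by rewrite bd_push ker_ofE raddf0. Qed.

Definition push_cyc X Y (f : smap X Y) n (z : cyc X n) : cyc Y n :=
  in_kerP (push_cyc_subproof f z).

Definition const_simplex X n (a : X) : simplex X n :=
  Simplex (ex_intro (fun p : plot X n.+1 => forall x, a = p (sval x))
    (plot_cst n.+1 a) (fun _ => erefl)).

Definition point_cyc X (a : X) : cyc X 0 :=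
  @in_kerP _ _ (@bd X 0) << const_simplex 0 a >> erefl.

Section Relative.
Variables (A X : @smoothSpace R) (f : smap A X).

(* Chains of a smooth map f : A -> X in degree n > 0:
   C_n(f) = C_n(X) + C_(n-1)(A). *)
Definition rchain n : Type := (schain X n * schain A n.-1)%type.
HB.instance Definition _ n := GRing.Zmodule.on (rchain n).

Definition rbd n (c : rchain n) : rchain n.-1 :=
  (bd c.1 + push_chain f c.2, - bd c.2).

Fact rbd_additive n : zmod_morphism (@rbd n).
Proof.
move=> c c'; by rewrite /rbd !raddfB /= addrACA -opprD.
Qed.
HB.instance Definition _ n :=
  GRing.isZmodMorphism.Build (rchain n) (rchain n.-1) (@rbd n) (@rbd_additive n).

Definition rcyc n : Type := ker_of (@rbd n).
HB.instance Definition _ n := GRing.Zmodule.on (rcyc n).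

Fact rcyc_snd_subproof n (z : rcyc n) : bd (val z).2 = 0.
Proof. by have /(congr1 snd)/eqP := ker_ofE z; rewrite /= oppr_eq0 => /eqP. Qed.

Definition rcyc_snd n (z : rcyc n) : cyc A n.-1 := in_kerP (rcyc_snd_subproof z).

End Relative.

Section PushRelative.
Variables (A X B Y : @smoothSpace R) (f : smap A X) (g : smap B Y).
Variables (F : smap A B) (H : smap X Y) (HF : forall a, g (F a) = H (f a)).

Fact push_push n (c : schain A n) : push_chain g (push_chain F c) = push_chain H (push_chain f c).
Proof.
apply: (@eq_additive_chain _ A n _ (@push_chain B Y g n \o @push_chain A B F n)
  (@push_chain X Y H n \o @push_chain A X f n)) c => s /=.
rewrite /push_chain !lin_extU; congr << _ >>.
by apply: simplex_eq => x; exact: HF.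
Qed.

Fact push_rcyc_subproof n (z : rcyc f n) :
  rbd g (n := n) (push_chain H (val z).1, push_chain F (val z).2) = 0.
Proof.
have := ker_ofE z; rewrite /rbd => -[z1 z2].
by rewrite /= !bd_push push_push -!raddfD -raddfN z1 z2 !raddf0.
Qed.

Definition push_rcyc n (z : rcyc f n) : rcyc g n := in_kerP (push_rcyc_subproof z).

End PushRelative.

End Homology.

Lemma bump_swap (i j k h m : nat) : bump i j = k -> bump k h = i -> bump i (bump j m) = bump k (bump h m).
Proof.
rewrite /bump. 
case: (leqP i j) => a E1; case: (leqP k h) => b E2;
case: (leqP j m) => c; case: (leqP h m) => d /=; 
case: leqP => e; case: leqP => f /=; lia. Qed.
Lemma bump_sum (i j k h : nat) : bump i j = k -> bump k h = i -> (i + j).+1 = k + h \/ (k + h).+1 = i + j.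
Proof.
rewrite /bump. 
case: (leqP i j) => a E1; case: (leqP k h) => b E2; lia. Qed.

Section BoundarySquared.
Context {R : realType}.
Implicit Types X Y A : @smoothSpace R.

Lemma face_map_swap n (i k : 'I_n.+3) (j h : 'I_n.+2) (x : 'rV[R]_n.+1) :
  fintype.lift i j = k -> fintype.lift k h = i ->
  face_map i (face_map j x) = face_map k (face_map h x).
Proof.
move=> ijk khi; apply/rowP => l; rewrite !mxE.
have sw (m : 'I_n.+1) : fintype.lift i (fintype.lift j m) =
    fintype.lift k (fintype.lift h m).
  by apply/val_inj; exact: (bump_swap _ (congr1 val ijk) (congr1 val khi)).
case: (unliftP i l) => [l' ->|->]; last first.
  by rewrite -khi liftK mxE unlift_none.
rewrite mxE; case: (unliftP j l') => [m ->|->].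
  by rewrite sw liftK mxE liftK.
by rewrite ijk unlift_none.
Qed.

Lemma bd_bd X n (c : schain X n) : bd (bd c) = 0.
Proof.
case: n c => [|[|n]] c; [by rewrite /= ?raddf0|by []|].
pose Z : {additive schain X n.+2 -> schain X n} := lin_ext (fun=> 0).
have -> : 0 = Z c.
  by rewrite -[c]freeg_sumE raddf_sum big1// => s _; rewrite chainU raddfMz /= lin_extU mul0rz.
apply: (@eq_additive_chain _ X n.+2 _ (@bd R X n.+1 \o @bd R X n.+2) Z) c => s.
rewrite /= !lin_extU raddf_sum /=.
pose T (i j : 'I_n.+3) : schain X n :=
  if unlift i j is Some j' then
    << simplex_face (simplex_face s i) j' >> *~ ((-1) ^+ (i + j')) else 0.
transitivity (\sum_i \sum_j T i j).
  apply: eq_bigr => i _; rewrite [X in lin_ext _ X]chainU raddfMz /= lin_extU.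
  rewrite (bigD1 i)//= {1}/T unlift_none add0r (reindex (fintype.lift i)) /=; last first.
    exists (fun j => odflt ord0 (unlift i j)) => j; first by rewrite liftK.
    by rewrite inE => ji; case: unliftP ji => [j' ->//|->]; rewrite eqxx.
  under [RHS]eq_bigl do rewrite eq_sym neq_lift.
  rewrite -[LHS]/((\sum_(j < n.+2) _) *~ _) mulrz_suml; apply: eq_bigr => j _.
  by rewrite /T liftK chainU -mulrzA exprD mulrC.
have Tasym i j : T i j = - T j i.
  rewrite /T; case: (unliftP i j) => [j' ji|->]; last by rewrite unlift_none oppr0.
  case: (unliftP j i) => [i' ij|ij]; last first.
    by move: ji; rewrite ij => /eqP; rewrite (negbTE (neq_lift _ _)).
  have -> : simplex_face (simplex_face s i) j' = simplex_face (simplex_face s j) i'.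
    apply: simplex_eq => x /=; congr (s _); apply/val_inj => /=.
    by apply: face_map_swap.
  rewrite -mulrNz; congr (_ *~ _).
  have : (i + j').+1 = (j + i')%N \/ (j + i').+1 = (i + j')%N.
    exact: (bump_sum (congr1 val (esym ji)) (congr1 val (esym ij))).
  by case=> <-; rewrite exprS mulN1r ?opprK.
have H : \sum_i \sum_j T i j = - \sum_i \sum_j T i j.
  rewrite [in RHS]exchange_big /= -sumrN; apply: eq_bigr => i _.
  by rewrite -sumrN; apply: eq_bigr => j _.
apply/eqP/freeg_eqP => t.
move/(congr1 (coeff t)) : H; rewrite raddfN /= => H.
have -> : coeff t (\sum_i \sum_j T i j) = 0.
  by apply/eqP; move/eqP: H; rewrite -subr_eq0 opprK -mulr2n mulrn_eq0.
by rewrite raddf0.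
Qed.
End BoundarySquared.

Section Boundaries.
Context {R : realType}.
Implicit Types X A : @smoothSpace R.

Definition bd_cyc X n (c : schain X n) : cyc X n.-1 := in_kerP (bd_bd c).

Fact rbd_rbd A X (f : smap A X) n (c : rchain A X n) : rbd f (rbd f c) = 0.
Proof.
rewrite /rbd /=; apply/eqP; rewrite xpair_eqE /=; apply/andP; split; apply/eqP.
  by rewrite raddfD /= bd_bd bd_push raddfN add0r subrr.
by rewrite raddfN /= bd_bd !oppr0.
Qed.

Definition rbd_cyc A X (f : smap A X) n (c : rchain A X n) : rcyc f n.-1 :=
  in_kerP (rbd_rbd f c).

End Boundaries.

Section Integration.
Context {R : realType}.
Implicit Types X A : @smoothSpace R.

(* Affine coordinates on the standard simplex; they fix its orientation. *)
Definition bary n (t : 'rV[R]_n) : 'rV[R]_n.+1 :=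
  (row_mx (1 - \sum_i t 0 i)%:M t : 'rV[R]_(1 + n)).

Fact smooth_bary n : smooth (@bary n).
Proof.
move=> k; apply: times_diff_row => i; rewrite /bary.
case: (@split_ordP 1 n i) => j ->; last first.
  rewrite (_ : (fun x => _) = fun x : 'rV[R]_n => x 0 j); first exact: smooth_coord.
  by apply/funext => x; exact: row_mxEr.
rewrite (_ : (fun x => _) = fun x : 'rV[R]_n => 1 + \sum_l - x 0 l); last first.
  by apply/funext => x; rewrite sumrN -[RHS]mulr1n (row_mxEl _ _ 0 j) ord1 mxE eqxx.
apply: times_diffD; first exact: times_diff_cst.
apply: times_diff_sum => l.
rewrite (_ : (fun x => _) = fun x : 'rV[R]_n => (-1) * x 0 l).
  by apply: times_diffM; [exact: times_diff_cst|exact: smooth_coord].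
by apply/funext => x; rewrite mulN1r.
Qed.

(* Integral over { t | 0 <= t_i, t_0 + .. + t_(n-1) <= a } as an iterated integral. *)
Fixpoint simplex_integral n (a : R) : ('rV[R]_n -> R) -> R :=
  match n return ('rV[R]_n -> R) -> R with
  | 0 => fun f => f 0
  | n'.+1 => fun f => \int[lebesgue_measure]_(t in `[0, a])
      simplex_integral (a - t) (fun y : 'rV[R]_n' => f (row_mx t%:M y : 'rV[R]_(1 + n')))
  end.

Definition simplex_ext X n (s : simplex X n) : plot X n.+1 :=
  projT1 (cid (simplexP s)).

(* The extension of s to R^(n+1) is picked by choice; the integrand on the
   simplex does not depend on it. *)
Definition int_simplex X n (w : rform X n R) (s : simplex X n) : R :=
  simplex_integral 1 (fun t =>
    w n (plot_comp (simplex_ext s) (@smooth_bary n)) t (fun i => delta_mx 0 i)).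

Definition int_chain X n (w : rform X n R) : schain X n -> R :=
  lin_ext (int_simplex w).

End Integration.

Section Circle.
Variable R : realType.

(* U(1), with its group structure written additively. *)
Definition circle : Type := {z : R[i] | `|z| == 1}.
HB.instance Definition _ := SubChoice.on circle.

Fact circle_mul_subproof (a b : circle) : `|val a * val b| == 1.
Proof. by rewrite normrM (eqP (valP a)) (eqP (valP b)) mulr1. Qed.
Definition circle_mul (a b : circle) : circle := Sub (val a * val b) (circle_mul_subproof a b).
Fact circle_inv_subproof (a : circle) : `|(val a)^-1| == 1.
Proof. by rewrite normfV (eqP (valP a)) invr1. Qed.
Definition circle_inv (a : circle) : circle := Sub (val a)^-1 (circle_inv_subproof a).
Fact circle_one_subproof : `|1 : R[i]| == 1.
Proof. by rewrite normr1. Qed.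
Definition circle_one : circle := exist _ (1 : R[i]) circle_one_subproof.

Fact circle_mulA : associative circle_mul.
Proof. by move=> a b c; apply/val_inj; rewrite /= mulrA. Qed.
Fact circle_mulC : commutative circle_mul.
Proof. by move=> a b; apply/val_inj; rewrite /= mulrC. Qed.
Fact circle_mul1 : left_id circle_one circle_mul.
Proof. by move=> a; apply/val_inj; rewrite /= mul1r. Qed.
Fact circle_mulV : left_inverse circle_one circle_inv circle_mul.
Proof.
move=> a; apply/val_inj; rewrite /= mulVf//.
by rewrite -normr_gt0 (eqP (valP a)) ltr01.
Qed.
HB.instance Definition _ := GRing.isZmodule.Build circle
  circle_mulA circle_mulC circle_mul1 circle_mulV.

Fact expi_subproof (t : R) :
  `|(cos (2 * pi * t) +i* sin (2 * pi * t))%C| == 1.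
Proof. by rewrite normc_def /= cos2Dsin2 sqrtr1. Qed.

Definition expi (t : R) : circle :=
  exist _ (cos (2 * pi * t) +i* sin (2 * pi * t))%C (expi_subproof t).

Definition circle_smooth (X : @smoothSpace R) (h : X -> circle) : Prop :=
  forall m (p : plot X m),
    smooth (fun x => complex.Re (val (h (p x)))) /\
    smooth (fun x => complex.Im (val (h (p x)))).

End Circle.
Arguments expi {R} t.

Section Characters.
Context {R : realType}.
Implicit Types X Y A : @smoothSpace R.

(* has_curv h w: curv(h) = w. *)
Definition has_curv X n (h : cyc X n.-1 -> circle R) (w : rform X n R) : Prop :=
  forall c : schain X n, h (bd_cyc c) = expi (int_chain w c).

(* The differential cohomology group of degree n >= 1, as a subset of the group
   of functions from (n-1)-cycles to U(1).  In degree 1 a smooth function on X is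
   identified with its extension to a homomorphism on 0-chains, as in the
   definition of ibreve_char. *)
Definition dchar X n : set (cyc X n.-1 -> circle R) :=
  match n return set (cyc X n.-1 -> circle R) with
  | 1 => [set h | zmod_morphism h /\ circle_smooth (fun x : X => h (point_cyc x))]
  | n' => [set h | zmod_morphism h /\
            exists w : rform X n' R, is_form w /\ has_curv h w]
  end.

Definition pull_dchar X Y (f : smap Y X) n (h : cyc X n -> circle R) :
    cyc Y n -> circle R :=
  fun z => h (push_cyc f z).

Section Relative.
Variables (A X : @smoothSpace R) (f : smap A X).

(* curv(h) = w and cov(h) = t. *)
Definition has_curv_cov n (h : rcyc f n.-1 -> circle R)
    (w : rform X n R) (t : rform A n.-1 R) : Prop :=
  forall c : rchain A X n, h (rbd_cyc f c) = expi (int_chain w c.1 + int_chain t c.2).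

(* The relative group of degree n >= 2. *)
Definition rdchar n : set (rcyc f n.-1 -> circle R) :=
  [set h | zmod_morphism h /\
    exists (w : rform X n R) (t : rform A n.-1 R),
      [/\ is_form w, is_form t & has_curv_cov h w t]].

Definition iota_char n (mu : rform X n.-1 R) (nu : rform A n.-1.-1 R) :
    rcyc f n.-1 -> circle R :=
  fun z => expi (int_chain mu (val z).1 + int_chain nu (val z).2).

Definition ibreve_char n (h : cyc A n.-1.-1 -> circle R) : rcyc f n.-1 -> circle R :=
  fun z => h (rcyc_snd z).

End Relative.
End Characters.

Section Cohomology.
Context {R : realType}.
Implicit Types X A : @smoothSpace R.

Definition cochain X n (M : zmodType) : Type := simplex X n -> M.
HB.instance Definition _ X n M := GRing.Zmodule.on (cochain X n M).

Definition cobd X n (M : zmodType) (mu : cochain X n.-1 M) : cochain X n M :=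
  fun s => lin_ext mu (bd << s >>).

(* A cohomology class is represented by its set of cocycles; cobd is the zero
   map into degree 0, because bd is zero on 0-chains. *)
Definition coh_class X n (M : zmodType) (mu : cochain X n M) : set (cochain X n M) :=
  [set mu + cobd nu | nu in setT].

Definition cohomology X n (M : zmodType) : Type :=
  {C : set (cochain X n M) |
    exists mu, @cobd X n.+1 M mu = 0 /\ C = coh_class mu}.

Variables (A X : @smoothSpace R) (f : smap A X).

Definition rcochain n (M : zmodType) : Type := (cochain X n M * cochain A n.-1 M)%type.
HB.instance Definition _ n M := GRing.Zmodule.on (rcochain n M).

Definition rcobd n (M : zmodType) (c : rcochain n.-1 M) : rcochain n M :=
  (cobd c.1, (fun s => c.1 (push_simplex f s)) - cobd c.2).

Definition rcoh_class n (M : zmodType) (c : rcochain n M) : set (rcochain n M) :=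
  [set c + rcobd b | b in setT].

Definition rcohomology n (M : zmodType) : Type :=
  {C : set (rcochain n M) |
    exists c, @rcobd n.+1 M c = 0 /\ C = rcoh_class c}.

(* c(h) = C *)
Definition is_char_class n (h : rcyc f n.-1 -> circle R) (C : rcohomology n int) : Prop :=
  exists (w : rform X n R) (t : rform A n.-1 R) (lift : rcyc f n.-1 -> R)
         (c : rcochain n int),
    [/\ is_form w, is_form t & has_curv_cov h w t] /\
    [/\ zmod_morphism lift,
        forall z, h z = expi (lift z),
        forall b : rchain A X n,
          (lin_ext c.1 b.1 + lin_ext c.2 b.2)%:~R =
          int_chain w b.1 + int_chain t b.2 - lift (rbd_cyc f b)
      & sval C = rcoh_class c].

(* H^n(f) -> H^n(X) maps C to u. *)
Definition restricts_to n (C : rcohomology n int) (u : cohomology X n int) : Prop :=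
  exists2 c, sval C c & sval u = coh_class c.1.

(* The de Rham class of w is the image of u in real cohomology. *)
Definition de_rham_eq n (w : rform X n R) (u : cohomology X n int) : Prop :=
  exists mu (nu : cochain X n.-1 R), sval u mu /\
    forall s : simplex X n, int_simplex w s - (mu s)%:~R = cobd nu s.

End Cohomology.

Section LieGroups.
Variable R : realType.

(* lie_coord and lie_param are coordinates near 1.  They identify the Lie algebra
   T_1 G with 'rV_(lie_dim G) through the differential of lie_coord at 1. *)
Record lieGroup := LieGroup {
  lie_group :> groupType;
  lie_diff : @diffeology R lie_group;
  lie_mul_smooth : forall m (p q : 'rV[R]_m -> lie_group),
    is_plot lie_diff p -> is_plot lie_diff q ->
    is_plot lie_diff (fun x => (p x * q x)%g);
  lie_inv_smooth : forall m (p : 'rV[R]_m -> lie_group),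
    is_plot lie_diff p -> is_plot lie_diff (fun x => (p x)^-1%g);
  lie_dim : nat;
  lie_manifold : finite_dim_manifold lie_dim (Space lie_diff);
  lie_coord : lie_group -> 'rV[R]_lie_dim;
  lie_param : 'rV[R]_lie_dim -> lie_group;
  lie_chart : exists V W, V 1%g /\
    @is_chart R (Space lie_diff) 'rV[R]_lie_dim
      (fun m => @smooth R m 'rV[R]_lie_dim) V W lie_coord lie_param
}.

Definition lie_space (G : lieGroup) : smoothSpace := Space (lie_diff G).

Definition lie_alg (G : lieGroup) : normedModType R := 'rV[R]_(lie_dim G).

Definition finitely_many_components (G : lieGroup) : Prop :=
  exists r : seq G, forall g : G, exists2 a, a \in r &
    exists c : plot (lie_space G) 1, c 0 = a /\ c (const_mx 1) = g.

Definition Ad (G : lieGroup) (g : G) (v : lie_alg G) : lie_alg G :=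
  'D_v (fun y => lie_coord (g * lie_param y * g^-1)%g) (lie_coord (1%g : G)).

(* ad, the differential of Ad at 1 in the direction v. *)
Definition bracket (G : lieGroup) (v w : lie_alg G) : lie_alg G :=
  'D_v (fun y => Ad (lie_param y) w) (lie_coord (1%g : G)).

Record inv_poly (G : lieGroup) k (lam : ('I_k -> lie_alg G) -> R) : Prop := InvPoly {
  inv_poly_linear : forall v i a (u u' : lie_alg G),
    lam [eta v with i |-> a *: u + u'] =
    a * lam [eta v with i |-> u] + lam [eta v with i |-> u'];
  inv_poly_sym : forall (s : 'S_k) v, lam (fun i => v (s i)) = lam v;
  inv_poly_Ad : forall (g : G) v, lam (fun i => Ad g (v i)) = lam v
}.

End LieGroups.

Section Bundles.
Variables (R : realType) (G : lieGroup R).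
Implicit Types X Y : @smoothSpace R.

(* s is a local section over V, and (y, g) |-> bundle_act (s y) g is a trivialization
   over V whose inverse is (bundle_proj, gam).  Values of s off V, and of gam off the
   preimage of V, are irrelevant. *)
Record principalBundle X := PrincipalBundle {
  total_space :> smoothSpace;
  bundle_proj : smap total_space X;
  bundle_act : total_space -> G -> total_space;
  bundle_act1 : forall p, bundle_act p 1%g = p;
  bundle_actM : forall p g h, bundle_act p (g * h)%g = bundle_act (bundle_act p g) h;
  act_smooth : forall m (p : plot total_space m) (g : plot (lie_space G) m),
    is_plot (space_diff total_space) (fun x => bundle_act (p x) (g x));
  bundle_proj_act : forall p g, bundle_proj (bundle_act p g) = bundle_proj p;
  locally_trivial : forall x, exists V (s : X -> total_space) (gam : total_space -> G),
    [/\ D_open V /\ V x,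
        forall y, V y -> bundle_proj (s y) = y,
        forall m (c : plot X m), (forall z, V (c z)) ->
          is_plot (space_diff total_space) (s \o c),
        forall m (c : plot total_space m), (forall z, V (bundle_proj (c z))) ->
          is_plot (lie_diff G) (gam \o c)
      & (forall p, V (bundle_proj p) -> bundle_act (s (bundle_proj p)) (gam p) = p) /\
        (forall y g, V y -> gam (bundle_act (s y) g) = g)]
}.

Section Pullback.
Variables (X Y : @smoothSpace R) (f : smap Y X) (P : principalBundle X).

(* Total space of the pull-back bundle f^*P over Y. *)
Definition pb_total : smoothSpace :=
  sub_space (X := prod_space Y P) [set z | f z.1 = bundle_proj P z.2].

Fact pb_proj_smooth m (p : plot pb_total m) :
  is_plot (space_diff Y) ((fun z : pb_total => (sval z).1) \o p).
Proof. exact: (proj1 (plotP p)). Qed.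
Definition pb_proj : smap pb_total Y := SMap pb_proj_smooth.

Fact pb_snd_smooth m (p : plot pb_total m) :
  is_plot (space_diff P) ((fun z : pb_total => (sval z).2) \o p).
Proof. exact: (proj2 (plotP p)). Qed.
Definition pb_snd : smap pb_total P := SMap pb_snd_smooth.

Fact pb_act_subproof (z : pb_total) (g : G) :
  f (sval z).1 = bundle_proj P (bundle_act (sval z).2 g).
Proof. by rewrite bundle_proj_act; exact: (svalP z). Qed.
Definition pb_act (z : pb_total) (g : G) : pb_total :=
  exist (fun z : prod_space Y P => f z.1 = bundle_proj P z.2)
    ((sval z).1, bundle_act (sval z).2 g) (pb_act_subproof z g).

Lemma pb_eq (z z' : pb_total) : sval z = sval z' -> z = z'.
Proof. exact: eq_sig_hprop => ? ? ?; exact: Prop_irrelevance. Qed.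

Fact pb_act1 z : pb_act z 1%g = z.
Proof. by apply: pb_eq; rewrite /= bundle_act1; case: (sval z). Qed.

Fact pb_actM z g h : pb_act z (g * h)%g = pb_act (pb_act z g) h.
Proof. by apply: pb_eq; rewrite /= bundle_actM. Qed.

Fact pb_act_smooth m (p : plot pb_total m) (g : plot (lie_space G) m) :
  is_plot (space_diff pb_total) (fun x => pb_act (p x) (g x)).
Proof.
split; first exact: (proj1 (plotP p)).
exact: (@act_smooth _ P m (smap_plot pb_snd p) g).
Qed.

Fact pb_locally_trivial y : exists V (s : Y -> pb_total) (gam : pb_total -> G),
    [/\ D_open V /\ V y,
        forall y, V y -> pb_proj (s y) = y,
        forall m (c : plot Y m), (forall z, V (c z)) ->
          is_plot (space_diff pb_total) (s \o c),
        forall m (c : plot pb_total m), (forall z, V (pb_proj (c z))) ->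
          is_plot (lie_diff G) (gam \o c)
      & (forall p, V (pb_proj p) -> pb_act (s (pb_proj p)) (gam p) = p) /\
        (forall y g, V y -> gam (pb_act (s y) g) = g)].
Proof.
have [V [s [gam [[oV Vy] sV ss sg [sgam gams]]]]] := locally_trivial P (f y).
have sE z : V (f z) -> f (z, s (f z)).1 = bundle_proj P (z, s (f z)).2.
  by move=> Vz /=; rewrite sV.
pose s' z : pb_total := match pselect (V (f z)) with
  | left Vz => exist (fun z : prod_space Y P => f z.1 = bundle_proj P z.2) (z, s (f z)) (sE z Vz)
  | right _ => exist (fun z : prod_space Y P => f z.1 = bundle_proj P z.2) (y, s (f y)) (sE y Vy)
  end.
have s'E z : V (f z) -> sval (s' z) = (z, s (f z)).
  by rewrite /s'; case: pselect.
exists (f @^-1` V), s', (fun z => gam (sval z).2); split.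
- by split=> // m p; exact: (oV m (smap_plot f p)).
- by move=> z Vz; rewrite /= s'E.
- move=> m c Vc.
  have E : (fun x => sval (s' (c x))) = fun x => (c x, s (f (c x))).
    by apply/funext => x; rewrite s'E//; exact: Vc.
  suff : is_plot (space_diff (prod_space Y P)) (fun x => sval (s' (c x))) by [].
  rewrite E; split; first exact: plotP.
  by apply: (ss m (smap_plot f c)) => z; exact: Vc.
- move=> m c Vc; apply: (sg m (smap_plot pb_snd c)) => z /=.
  by rewrite -(svalP (c z)); exact: Vc.
- split=> [p Vp|z g Vz].
    apply: pb_eq => /=; rewrite s'E//=.
    have fp := svalP p; rewrite /= in fp; rewrite fp sgam -?fp//.
    by case: (sval p).
  by rewrite /= s'E//= gams.
Qed.

Definition pullback_bundle : principalBundle Y :=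
  @PrincipalBundle Y pb_total pb_proj pb_act pb_act1 pb_actM pb_act_smooth
    (fun _ _ => erefl) pb_locally_trivial.

End Pullback.
End Bundles.

Section ChernWeil.
Variables (R : realType) (G : lieGroup R).
Implicit Types X Y : @smoothSpace R.

Definition act_plot X (P : principalBundle G X) m (p : plot P m)
    (g : plot (lie_space G) m) : plot P m :=
  Plot (act_smooth p g).

(* conn_vertical: theta maps the velocity at 0 of the curve p.c(t), c(0) = 1, to
   the velocity c'(0) in the Lie algebra. *)
Record is_connection X (P : principalBundle G X)
    (theta : rform P 1 (lie_alg G)) : Prop := IsConnection {
  conn_form : is_form theta;
  conn_equivariant : forall m (p : plot P m) (g : G) x v,
    theta m (act_plot p (plot_cst m (g : lie_space G))) x v =
    Ad g^-1%g (theta m p x v);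
  conn_vertical : forall (p : P) (c : plot (lie_space G) 1), c 0 = 1%g ->
    theta 1%N (act_plot (plot_cst 1 p) c) 0 (fun=> const_mx 1) =
    'D_(const_mx 1) (fun y => lie_coord (c y)) 0
}.

(* d theta + 1/2 [theta, theta] *)
Definition curvature X (P : principalBundle G X) (theta : rform P 1 (lie_alg G)) :
    rform P 2 (lie_alg G) :=
  fun m p x v =>
    'D_(v ord0) (fun y => theta m p y (fun=> v ord_max)) x
    - 'D_(v ord_max) (fun y => theta m p y (fun=> v ord0)) x
    + bracket (theta m p x (fun=> v ord0)) (theta m p x (fun=> v ord_max)).

Fact pair_index_subproof k (i : 'I_k) (b : 'I_2) : (i.*2 + b < k.*2)%N.
Proof.
by have := ltn_ord i; have := ltn_ord b; lia.
Qed.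

Definition pair_index k (i : 'I_k) (b : 'I_2) : 'I_(k.*2) :=
  Ordinal (pair_index_subproof i b).

(* The horizontal form lambda(F^k) on the total space; the factor 2^-k and the
   formula for d in the curvature belong to the same normalization of wedge
   products.  CW(lambda) is the form on the base that it descends to. *)
Definition CW_total X (P : principalBundle G X) (theta : rform P 1 (lie_alg G))
    k (lam : ('I_k -> lie_alg G) -> R) : rform P k.*2 R :=
  fun m p x v => 2^-1 ^+ k * \sum_(s : 'S_(k.*2)) (-1) ^+ s *
    lam (fun i => curvature theta p x (fun b => v (s (pair_index i b)))).

Definition is_CW X (P : principalBundle G X) (theta : rform P 1 (lie_alg G))
    k (lam : ('I_k -> lie_alg G) -> R) (w : rform X k.*2 R) : Prop :=
  is_form w /\ pull_form (bundle_proj P) w = CW_total theta lam.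

Section ChernSimons.
Variables (X : @smoothSpace R) (P : principalBundle G X) (theta : rform P 1 (lie_alg G)).

(* pi^*P -> P, the second component of a point is in the pulled back fibre. *)
Definition square_bundle : principalBundle G P := pullback_bundle (bundle_proj P) P.

Fact taut_subproof m (p : plot P m) :
  is_plot (space_diff square_bundle)
    ((fun a : P => exist (fun z : prod_space P P => bundle_proj P z.1 = bundle_proj P z.2)
       (a, a) erefl) \o p).
Proof. by split; exact: plotP. Qed.

Definition taut_section : smap P square_bundle := SMap taut_subproof.

(* The flat connection for which the tautological section is parallel. *)
Definition is_taut_connection (tau : rform square_bundle 1 (lie_alg G)) : Prop :=
  [/\ is_connection tau,
      curvature tau = @zero_form R square_bundle 2 (lie_alg G)
    & pull_form taut_section tau = @zero_form R P 1 (lie_alg G)].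

(* pi^*P x R -> P x R *)
Definition cylinder_bundle : principalBundle G (prod_space P real_line) :=
  pullback_bundle (smap_comp (bundle_proj P) (fst_smap P real_line)) P.

Definition cyl_snd : smap cylinder_bundle P := pb_snd _ P.

Fact cyl_square_eq (z : cylinder_bundle) :
  bundle_proj P (sval z).1.1 = bundle_proj P (sval z).2.
Proof. exact: (svalP z). Qed.

Definition cyl_square_fun (z : cylinder_bundle) : square_bundle :=
  exist (fun z : prod_space P P => bundle_proj P z.1 = bundle_proj P z.2)
    ((sval z).1.1, (sval z).2) (cyl_square_eq z).

Fact cyl_square_smooth m (p : plot cylinder_bundle m) :
  is_plot (space_diff square_bundle) (cyl_square_fun \o p).
Proof.
by split; [exact: (proj1 (proj1 (plotP p)))|exact: (proj2 (plotP p))].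
Qed.

Definition cyl_square : smap cylinder_bundle square_bundle := SMap cyl_square_smooth.

(* (1 - t) theta_taut + t pi^*theta *)
Definition path_connection (tau : rform square_bundle 1 (lie_alg G)) :
    rform cylinder_bundle 1 (lie_alg G) :=
  fun m p x v => let t : R := (sval (p x)).1.2 in
    (1 - t) *: pull_form cyl_square tau p x v
    + t *: pull_form cyl_snd theta p x v.

Definition is_CS k (lam : ('I_k -> lie_alg G) -> R)
    (cs : rform P (k.*2).-1 R) : Prop :=
  exists tau (w : rform (prod_space P real_line) k.*2 R),
    [/\ is_taut_connection tau,
        is_CW (path_connection tau) lam w
      & cs = fibre_integral w].

End ChernSimons.

(* A presentation of (P, theta) as the pull-back of (Q, eta). *)
Record classifying_map X (P : principalBundle G X) (theta : rform P 1 (lie_alg G))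
    Y (Q : principalBundle G Y) (eta : rform Q 1 (lie_alg G)) := ClassifyingMap {
  cl_base : smap X Y;
  cl_total : smap P Q;
  cl_proj : forall p, bundle_proj Q (cl_total p) = cl_base (bundle_proj P p);
  cl_act : forall p g, cl_total (bundle_act p g) = bundle_act (cl_total p) g;
  cl_conn : pull_form cl_total eta = theta
}.

(* A universal bundle with a universal connection.  The classifying property is
   required over second countable finite-dimensional manifolds, the range of
   the Narasimhan-Ramanan theorem. *)
Record universalBundle := UniversalBundle {
  BG : @smoothSpace R;
  EG : principalBundle G BG;
  univ_conn : rform EG 1 (lie_alg G);
  univ_connP : is_connection univ_conn;
  EG_contractible : contractible EG;
  univ_classifies : forall d X (P : principalBundle G X) (theta : rform P 1 (lie_alg G)),
    finite_dim_manifold d X -> D_second_countable X -> is_connection theta ->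
    inhabited (classifying_map theta univ_conn)
}.

Arguments univ_conn _ : clear implicits.

Variable E : universalBundle.

Definition K_group k (lam : ('I_k -> lie_alg G) -> R)
    (u : cohomology (BG E) k.*2 int) : Prop :=
  inv_poly lam /\
  exists2 w, is_CW (univ_conn E) lam w & de_rham_eq w u.

(* The character on EG -> BG with the prescribed curvature, covariant derivative
   and characteristic class. *)
Definition is_universal_CCS k (lam : ('I_k -> lie_alg G) -> R)
    (u : cohomology (BG E) k.*2 int)
    (h : rcyc (bundle_proj (EG E)) (k.*2).-1 -> circle R) : Prop :=
  rdchar h /\
  (exists w cs, [/\ is_CW (univ_conn E) lam w, is_CS (univ_conn E) lam cs
                  & has_curv_cov h w cs]) /\
  (exists C, is_char_class h C /\ restricts_to C u).

(* The pull-back of the universal character along a classifying map. *)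
Definition is_CCS k (lam : ('I_k -> lie_alg G) -> R)
    (u : cohomology (BG E) k.*2 int)
    X (P : principalBundle G X) (theta : rform P 1 (lie_alg G))
    (ccs : rcyc (bundle_proj P) (k.*2).-1 -> circle R) : Prop :=
  exists (F : classifying_map theta (univ_conn E)) h,
    is_universal_CCS lam u h /\ ccs = fun z => h (push_rcyc (cl_proj F) z).

Definition diff_trivializations k X (P : principalBundle G X)
    (ccs : rcyc (bundle_proj P) (k.*2).-1 -> circle R) :
    set (cyc P (k.*2).-1.-1 -> circle R) :=
  [set q | @dchar R P (k.*2).-1 q /\
    exists rho : rform X (k.*2).-1 R, is_form rho /\
      - @ibreve_char R P X (bundle_proj P) k.*2 q =
      ccs - @iota_char R P X (bundle_proj P) k.*2 rho (zero_form R)].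

End ChernWeil.
Arguments univ_conn {R G} _.

Section Torsors.
Variables (V : zmodType) (S : Type).

Definition is_subgroup (H : set V) : Prop :=
  H 0 /\ forall x y, H x -> H y -> H (x - y).

Definition is_group_action (H : set V) (T : set S) (a : S -> V -> S) : Prop :=
  [/\ is_subgroup H,
      forall s x, T s -> H x -> T (a s x),
      forall s, T s -> a s 0 = s
    & forall s x y, T s -> H x -> H y -> a s (x + y) = a (a s x) y].

Definition is_torsor (H : set V) (T : set S) (a : S -> V -> S) : Prop :=
  [/\ is_group_action H T a,
      forall s x, T s -> H x -> a s x = s -> x = 0
    & forall s s', T s -> T s' -> exists2 x, H x & a s x = s'].

End Torsors.

(* Main.v *)
From HB Require Import structures.
Require Import Defs.
From mathcomp Require Import all_boot all_order all_algebra.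
From mathcomp Require Import all_classical all_reals all_analysis.
From mathcomp Require Import complex freeg ring lra zify.

Set Implicit Arguments.
Unset Strict Implicit.
Unset Printing Implicit Defensive.

Import numFieldNormedType.Exports.
Import Order.TTheory GRing.Theory Num.Theory.
Local Open Scope classical_set_scope.
Local Open Scope ring_scope.

(** The argument takes place over a smooth map f : A -> X, the bundle projection
P -> X, with a function c0 on its relative cycles, the Cheeger-Chern-Simons
character, and characters of degree m + 1.

Write q(t) for the value of a character q of A on the second component t of a
relative cycle (s, t), so that bd s + f_* t = 0.  A trivialization is a q with
q(t) = exp(2 pi i int_s rho) - c0(s, t), written additively, for some form rho
on X.  A character h of X with curvature w satisfies
(f^* h)(t) = h(bd (- s)) = - exp(2 pi i int_s w), so adding f^* h to q replaces
rho by rho - w: the group acts ([trivializations_act]).  The action is by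
translations, so it is free on the subgroup of the f^* h.

For transitivity let q, q' be trivializations for rho, rho', put d = q' - q and
nu = rho - rho'.  Then d(t) = - exp(2 pi i int_s nu) on every relative cycle,
which says exactly that f_* t + bd s |-> d(t) + exp(2 pi i int_s nu) is well
defined on the subgroup f_* Z(A) + B(X) of Z(X).  As U(1) is divisible, this
homomorphism extends to an h on all of Z(X) ([extend_hom]); its values on
boundaries say that its curvature is nu, and its values on f_* Z(A) say that
f^* h = d ([trivializations_transitive]).

Two analytic points remain.  Pulling back characters and subtracting curvatures
needs the integral of a form over a smooth simplex to be independent of the
smooth extension of the simplex, natural, and additive in the form
([int_simplexE], [int_chain_push], [int_chainB]).  And in degree 1 a character is
a smooth U(1)-valued function rather than a homomorphism with a curvature form;
[dcharP] shows that both descriptions agree, so that degree 1 needs no separate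
argument.  A smooth function has its logarithmic derivative as curvature
([dlog_curv]).  Conversely, a function whose increments along segments are
exponentials of integrals of a smooth 1-form is differentiable with derivative
given by that form and the function itself, hence smooth ([smooth_of_curv]). *)

(** * Extension of homomorphisms into divisible groups *)

Definition divisible (D : zmodType) : Prop :=
  forall (d : D) n, (0 < n)%N -> exists e, e *+ n = d.

Section ExtendHom.
Variables V D : zmodType.

Lemma pairN (x : V) (e : D) : - (x, e) = (- x, - e).
Proof. by []. Qed.

Lemma pairB (x y : V) (d e : D) : (x, d) - (y, e) = (x - y, d - e).
Proof. by []. Qed.

(** A partially defined homomorphism V -> D, represented by its graph: as a set
of pairs, partial homomorphisms can be united along chains. *)
Definition subgraph (M : set (V * D)) : Prop :=
  [/\ M 0, forall p q, M p -> M q -> M (p - q) & forall d, M (0, d) -> d = 0].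

Lemma subgraphN M p : subgraph M -> M p -> M (- p).
Proof. by case=> M0 MB _ Mp; rewrite -sub0r; exact: MB. Qed.

Lemma subgraphD M p q : subgraph M -> M p -> M q -> M (p + q).
Proof.
by move=> gM Mp Mq; rewrite -[q]opprK; have [_ MB _] := gM; apply: MB => //; exact: subgraphN.
Qed.

Lemma subgraphMz M p (k : int) : subgraph M -> M p -> M (p *~ k).
Proof.
move=> gM Mp; have Mn n : M (p *+ n).
  by elim: n => [|n IH]; [rewrite mulr0n; case: gM|rewrite mulrS; exact: subgraphD].
by case: k => n; [exact: Mn|rewrite NegzE mulrNz; exact/(subgraphN gM)/Mn].
Qed.

Lemma subgraph_uniq M v d e : subgraph M -> M (v, d) -> M (v, e) -> d = e.
Proof.
move=> [_ MB M0] Md Me; apply/eqP; rewrite -subr_eq0; apply/eqP/M0.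
by rewrite -[0](subrr v); exact: MB Md Me.
Qed.

Lemma pairMz (x : V) (e : D) (k : int) : (x, e) *~ k = (x *~ k, e *~ k).
Proof.
by rewrite [LHS]surjective_pairing (raddfMz fst) (raddfMz snd).
Qed.

(** The value e that a partial homomorphism can be given at x.  The k with
k x in the domain form n Z; for n > 0 the value at x must be an n-th part of the
value at n x, and divisibility provides one. *)
Lemma subgraph_value M x : divisible D -> subgraph M ->
  exists e, forall k d, M (x *~ k, d) -> d = e *~ k.
Proof.
move=> divD gM.
have [[n [n0 [d0 Mnd]]]|no] := pselect (exists n, (0 < n)%N /\ exists d, M (x *+ n, d)); last first.
  exists 0 => k d Mkd; rewrite mul0rz; case: (posnP `|k|%N) => [/eqP|k0].
    by rewrite absz_eq0 => /eqP k0; move: Mkd; rewrite k0 mulr0z; case: gM => _ _; apply.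
  case: no; exists `|k|%N; split=> //.
  case: k => n in k0 Mkd *; first by exists d.
  exists (- d); have := subgraphN gM Mkd.
  by rewrite pairN NegzE mulrNz opprK.
(* The least n > 0 such that n x is in the domain. *)
pose Q n := `[< (0 < n)%N /\ exists d, M (x *+ n, d) >].
have exQ : exists n, Q n by exists n; apply/asboolP; split=> //; exists d0.
have [{n n0 d0 Mnd exQ} n /asboolP[n0 [d0 Mnd]] nmin] := ex_minnP exQ.
have [e ed] := divD d0 n n0; exists e => k d Mkd.
have kE := divz_eq k n; set q := (k %/ n)%Z in kE; set r := (k %% n)%Z in kE.
have rE : r = `|r|%N by rewrite gez0_abs// modz_ge0; lia.
have rn : (`|r| < n)%N by rewrite -ltz_nat -rE ltz_mod; lia.
have Mqd : M (x *~ (q * n), d0 *~ q).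
  by rewrite mulrC mulrzA -pairMz; exact: subgraphMz.
have Mr : M (x *~ r, d - d0 *~ q).
  have [_ MB _] := gM; have := MB _ _ Mkd Mqd.
  rewrite pairB -mulrzBr.
  by rewrite {1}kE [_ + r]addrC addrK.
have r0 : r = 0.
  have [|r0] := posnP `|r|%N; first by move=> r0; rewrite rE r0.
  have : (n <= `|r|)%N.
    by apply: nmin; apply/asboolP; split=> //; exists (d - d0 *~ q); move: Mr; rewrite {1}rE.
  by rewrite leqNgt rn.
have [_ _ M0] := gM; move: Mr; rewrite r0 mulr0z => /M0/eqP.
by rewrite subr_eq0 => /eqP->; rewrite kE r0 addr0 -ed mulrC mulrzA.
Qed.

Lemma subgraph_adjoin M x : divisible D -> subgraph M ->
  exists M', [/\ subgraph M', M `<=` M' & exists e, M' (x, e)].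
Proof.
move=> divD gM; have [e eP] := subgraph_value x divD gM.
exists [set p | exists k, M (p - (x, e) *~ k)].
have [M0 MB Mf] := gM.
split; [split| |].
- by exists 0; rewrite mulr0z subr0.
- move=> p q [k Mp] [l Mq]; exists (k - l).
  rewrite mulrzBr opprB addrACA [- q + _]addrC.
  by have := MB _ _ Mp Mq; rewrite opprB addrACA.
- move=> d [k]; rewrite pairMz pairB sub0r -mulrNz.
  by move=> /eP; rewrite mulrNz => /(canRL (subrK _)); rewrite addNr.
- by move=> p Mp; exists 0; rewrite mulr0z subr0.
- by exists e, 1; rewrite mulr1z subrr.
Qed.

(** Divisible groups are injective: a maximal partial homomorphism is total,
because any point can be adjoined to its domain. *)
Lemma extend_hom (M : set (V * D)) : divisible D -> subgraph M ->
  exists2 F : V -> D, zmod_morphism F & forall v d, M (v, d) -> F v = d.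
Proof.
move=> divD gM.
(* M is joined to A so that the union of the empty chain is admissible too. *)
pose Q (A : set (V * D)) := subgraph (M `|` A).
have chainQ (C : set (set (V * D))) : C `<=` Q -> total_on C subset ->
    Q (\bigcup_(A in C) A).
  move=> CQ totC; rewrite /Q.
  have [[A0 CA0]|C0] := pselect (C !=set0); last first.
    rewrite (_ : \bigcup_(A in C) A = set0) ?setU0//.
    by apply/seteqP; split=> // p [A CA _]; case: C0; exists A.
  split.
  - by left; case: gM.
  - have common p q : (M `|` \bigcup_(A in C) A) p -> (M `|` \bigcup_(A in C) A) q ->
        exists2 A, C A & (M `|` A) p /\ (M `|` A) q.
      move=> [Mp|[A CA Ap]] [Mq|[B CB Bq]].
      + by exists A0 => //; split; left.
      + by exists B => //; split; [left|right].
      + by exists A => //; split; [right|left].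
      + have [AB|BA] := totC _ _ CA CB.
          by exists B => //; split; right => //; exact: AB.
        by exists A => //; split; right => //; exact: BA.
    move=> p q Hp Hq; have [A CA [Ap Aq]] := common _ _ Hp Hq.
    have [_ MB _] := CQ A CA; have [Mpq|Apq] := MB _ _ Ap Aq; first by left.
    by right; exists A.
  - move=> d [Md|[A CA Ad]]; first by case: gM => _ _; apply.
    by have [_ _] := CQ A CA; apply; right.
have [A [QA maxA]] := Zorn_bigcup chainQ.
have tot x : exists e, (M `|` A) (x, e).
  have [M' [gM' sub [e M'e]]] := subgraph_adjoin x divD QA.
  have [//|ne] := pselect (exists e, (M `|` A) (x, e)).
  exfalso; apply: (maxA M').
    split; first by move=> p Ap; apply: sub; right.
    by move=> M'A; apply: ne; exists e; right; exact: M'A.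
  rewrite /Q (_ : M `|` M' = M')//; apply/setUidr => p Mp.
  by apply: sub; left.
pose F x := projT1 (cid (tot x)).
have FP x : (M `|` A) (x, F x) by rewrite /F; case: cid.
exists F => [x y|v d Mvd].
  apply: (subgraph_uniq QA (FP _)); have [_ MB _] := QA.
  exact: (MB _ _ (FP x) (FP y)).
by apply: (subgraph_uniq QA (FP _)); left.
Qed.

End ExtendHom.

Section CircleDivisible.
Variable R : realType.

Lemma expiD (s t : R) : expi (s + t) = expi s + expi t.
Proof.
apply/val_inj; rewrite /= mulrDr cosD sinD.
by apply/eqP; rewrite eq_complex /= eqxx /= addrC [X in _ + X]mulrC eqxx.
Qed.

Lemma expi0 : expi 0 = 0 :> circle R.
Proof. by apply/val_inj; rewrite /= mulr0 cos0 sin0. Qed.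

Lemma expiN (t : R) : expi (- t) = - expi t.
Proof.
by apply/eqP; rewrite eq_sym -subr_eq0 -opprD oppr_eq0 -expiD subrr expi0.
Qed.

Lemma expiB (s t : R) : expi (s - t) = expi s - expi t.
Proof. by rewrite expiD expiN. Qed.

Lemma expiMn (t : R) n : expi (t *+ n) = expi t *+ n.
Proof. by elim: n => [|n IH]; rewrite ?mulr0n ?expi0// !mulrS expiD IH. Qed.

Lemma circle_sqr (z : circle R) :
  complex.Re (val z) ^+ 2 + complex.Im (val z) ^+ 2 = 1.
Proof.
have /eqP := valP z; rewrite normc_def => /(congr1 (@complex.Re R)) /= /eqP.
rewrite -[X in _ == X]sqrtr1 eqr_sqrt//; first by move/eqP.
by rewrite addr_ge0// sqr_ge0.
Qed.

(** The angle is the arc cosine of the real part, with the sign of the imaginary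
part. *)
Lemma expi_surj (z : circle R) : exists t : R, expi t = z.
Proof.
have zz := circle_sqr z; case: z zz => -[x y] /= xy1 zz.
have pi2 : 2 * pi != 0 :> R by rewrite mulf_neq0 ?pnatr_eq0// gt_eqF// pi_gt0.
have x1 : -1 <= x <= 1 by apply/andP; nra.
exists ((if 0 <= y then acos x else - acos x) / (2 * pi)).
apply/val_inj; rewrite /= mulrCA divff// mulr1.
have s2 : Num.sqrt (1 - x ^+ 2) = `|y| by rewrite -zz addrC addKr sqrtr_sqr.
have xi : x \in `[(-1), 1] by rewrite in_itv.
case: leP => y0.
  by rewrite acosK// sin_acos// s2 ger0_norm.
by rewrite cosN sinN acosK// sin_acos// s2 ltr0_norm// opprK.
Qed.

Lemma circle_divisible : divisible (circle R).
Proof.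
move=> z n n0; have [t <-] := expi_surj z; exists (expi (t / n%:R)).
by rewrite -expiMn -[(_ / _) *+ _]mulr_natr divfK// pnatr_eq0 -lt0n.
Qed.

End CircleDivisible.

(** * Iterated integrals of continuous functions *)

Section ContinuityHelpers.
Variables T U V : topologicalType.

Lemma continuous_pair (f : T -> U) (g : T -> V) :
  continuous f -> continuous g -> continuous (fun x => (f x, g x)).
Proof. by move=> cf cg x; exact: (cvg_pair (cf x) (cg x)). Qed.

Lemma continuous_fst : continuous (@fst U V).
Proof. by move=> x; exact: cvg_fst. Qed.

Lemma continuous_snd : continuous (@snd U V).
Proof. by move=> x; exact: cvg_snd. Qed.

Lemma continuous_compose (f : T -> U) (g : U -> V) :
  continuous f -> continuous g -> continuous (fun x => g (f x)).
Proof. by move=> cf cg x; exact: (continuous_comp (cf x) (cg (f x))). Qed.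

End ContinuityHelpers.

Section IteratedIntegral.
Variable R : realType.
Notation mu := (@lebesgue_measure R).

Lemma continuous_integrable (a b : R) (f : R -> R) :
  continuous f -> mu.-integrable `[a, b] (EFin \o f).
Proof.
move=> cf; apply: continuous_compact_integrable; first exact: segment_compact.
exact: continuous_subspaceT.
Qed.

(** Reduces continuity in the upper bound to nonnegative bounds. *)
Lemma Rintegral_seg_max0 (x : R) (g : R -> R) :
  \int[mu]_(t in `[0, x]) g t = \int[mu]_(t in `[0, Num.max x 0]) g t.
Proof.
case: (leP 0 x) => // x0.
by rewrite set_itv1 Rintegral_set1 set_itv_ge ?Rintegral_set0// bnd_simp -ltNge.
Qed.

Lemma normr_Rintegral_le (a b M : R) (g : R -> R) : a <= b -> continuous g ->
  (forall t, a <= t <= b -> `|g t| <= M) ->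
  `|\int[mu]_(t in `[a, b]) g t| <= M * (b - a).
Proof.
move=> ab cg gM; have ig := continuous_integrable a b cg.
apply: le_trans (le_normr_Rintegral _ ig) _ => //.
have -> : M * (b - a) = \int[mu]_(t in `[a, b]) M.
  rewrite Rintegral_cst//= lebesgue_measure_itv /= lte_fin.
  by case: ltP => //= ba; rewrite (@le_anti _ _ a b) ?ab// subrr.
apply: le_Rintegral => //.
- apply: (continuous_integrable a b (f := fun x => `|g x|)) => x.
  exact/(@cvg_norm _ _ _ _ _ _)/cg.
- by apply: continuous_integrable; exact: cst_continuous.
Qed.

Lemma Rintegral_seg_lip (x y M : R) (g : R -> R) :
  0 <= x -> x <= y -> continuous g ->
  (forall t, 0 <= t <= y -> `|g t| <= M) ->
  `|\int[mu]_(t in `[0, y]) g t - \int[mu]_(t in `[0, x]) g t| <= M * (y - x).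
Proof.
move=> x0 xy cg gM; rewrite Rintegral_itvB ?bnd_simp//; last exact: continuous_integrable.
rewrite Rintegral_itv_obnd_cbnd; last first.
  have := continuous_integrable x y cg.
  by apply: integrableS => //; apply: subset_itvr; rewrite bnd_simp.
apply: normr_Rintegral_le => // t /andP[xt ty]; apply: gM; rewrite ty andbT.
exact: le_trans xt.
Qed.

(** The tube lemma: continuity is uniform over the compact factor [0, b]. *)
Lemma tube_near (T : topologicalType) (K : T * R -> R) (p0 : T) (b e : R) :
  continuous K -> 0 < e ->
  \forall p \near p0, forall t, 0 <= t <= b -> `|K (p, t) - K (p0, t)| < e.
Proof.
move=> cK e0.
have [/(_ (@segment_compact R 0 b)) cov _] := compact_near_coveringP `[(0 : R), b].
suff : \forall p \near p0, `[(0 : R), b] `<=` (fun t => `|K (p, t) - K (p0, t)| < e).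
  by apply: filterS => p Hp t t0b; apply: Hp; rewrite /= in_itv.
apply: (cov T (nbhs p0) (fun p t => `|K (p, t) - K (p0, t)| < e)).
move=> t _; have /cvgrPdist_lt/(_ (e / 2)) := cK (p0, t).
rewrite divr_gt0// => /(_ isT)[[U V]] /= [Up Vt] UV.
exists (V, U) => //= -[t' p] /= [Vt' Up'].
have H1 := UV (p, t') (conj Up' Vt').
have H2 := UV (p0, t') (conj (nbhs_singleton Up) Vt').
rewrite /= in H1 H2.
rewrite (_ : K (p, t') - _ = (K (p0, t) - K (p0, t')) - (K (p0, t) - K (p, t'))); last by ring.
by apply: le_lt_trans (ler_normB _ _) _; rewrite (splitr e) ltrD.
Qed.

(** Near p0 the integrand moves little uniformly in t, and the upper bound moves
little against a bounded integrand; J below changes the integrand only. *)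
Lemma continuous_Rintegral_upto_ge0 (T : topologicalType) (b : T -> R) (K : T * R -> R) :
  (forall p, 0 <= b p) -> continuous b -> continuous K ->
  continuous (fun p => \int[mu]_(t in `[0, b p]) K (p, t)).
Proof.
move=> b0 cb cK p0; have cKp p : continuous (fun t => K (p, t)).
  apply: (continuous_compose (f := fun t => (p, t))) cK.
  by apply: continuous_pair => x; [exact: cst_continuous|exact: cvg_id].
have [M M0 gM] : exists2 M, 0 < M & forall t, 0 <= t <= b p0 + 1 -> `|K (p0, t)| <= M.
  have cn : {within `[0, b p0 + 1], continuous (fun t => `|K (p0, t)|)}.
    by apply: continuous_subspaceT => t; exact/(@cvg_norm _ _ _ _ _ _)/cKp.
  have b10 : 0 <= b p0 + 1 by rewrite addr_ge0// b0.
  have [c _ cM] := EVT_max b10 cn; exists (`|K (p0, c)| + 1).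
    by rewrite ltr_wpDl.
  by move=> t tb; rewrite (le_trans (cM t _)) ?in_itv// lerDl.
apply/cvgrPdist_le => e e0; have b1 : 0 < b p0 + 1 by rewrite ltr_wpDl// b0.
(* A change of the integrand by e1 costs at most e / 2 on an interval of length at
   most b p0 + 1; so does a change of the bound by e2 when the integrand is at most M. *)
pose e1 := e / 2 / (b p0 + 1); have e10 : 0 < e1 by rewrite !divr_gt0.
pose e2 := Num.min 1 (e / 2 / M).
have e20 : 0 < e2 by rewrite lt_min ltr01 !divr_gt0.
have nb : \forall p \near p0, `|b p0 - b p| < e2.
  by have /cvgrPdist_lt := cb p0; apply.
near=> p.
have H1 : forall t, 0 <= t <= b p0 + 1 -> `|K (p, t) - K (p0, t)| < e1.
  by near: p; exact: tube_near.
have : `|b p0 - b p| < e2 by near: p.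
rewrite lt_min => /andP[bp1 bp2].
have bp : b p <= b p0 + 1 by move: bp1; rewrite ltr_norml => /andP[]; lra.
set I0 := \int[mu]_(t in _) _; set I1 := \int[mu]_(t in _) _.
pose J := \int[mu]_(t in `[0, b p]) K (p0, t).
have HJ1 : `|J - I1| <= e / 2.
  rewrite /J /I1 -RintegralB//; [|exact: continuous_integrable..].
  apply: le_trans (normr_Rintegral_le (M := e1) _ _ _) _ => //.
  - by move=> t; apply: continuousB; exact: cKp.
  - move=> t /andP[t0 tb]; rewrite distrC ltW// H1// t0/=; exact: le_trans bp.
  - rewrite subr0; apply: le_trans (_ : e1 * (b p0 + 1) <= _).
      by rewrite ler_wpM2l// ltW.
    by rewrite /e1 divfK// gt_eqF.
have HJ0 : `|I0 - J| <= e / 2.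
  apply: le_trans (_ : M * `|b p0 - b p| <= _); last first.
    by rewrite mulrC -ler_pdivlMr// ltW.
  case: (leP (b p) (b p0)) => pp.
    rewrite [`|b p0 - _|]ger0_norm ?subr_ge0//; apply: Rintegral_seg_lip => //.
    by move=> t /andP[t0 tb]; apply: gM; rewrite t0/= (le_trans tb)// lerDl ler01.
  rewrite [`|b p0 - _|]ler0_norm ?subr_le0; last exact: ltW.
  rewrite [- (b p0 - _)]opprB.
  rewrite -[`|I0 - J|]normrN [- (I0 - J)]opprB.
  apply: Rintegral_seg_lip => //; first exact: ltW.
  by move=> t /andP[t0 tb]; apply: gM; rewrite t0/= (le_trans tb).
rewrite (_ : I0 - I1 = (I0 - J) + (J - I1)); last by ring.
by apply: le_trans (ler_normD _ _) _; rewrite (splitr e) lerD.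
Unshelve. all: by end_near. Qed.

Lemma continuous_Rintegral_upto (T : topologicalType) (a : T -> R) (K : T * R -> R) :
  continuous a -> continuous K ->
  continuous (fun p => \int[mu]_(t in `[0, a p]) K (p, t)).
Proof.
move=> ca cK; under eq_fun do rewrite Rintegral_seg_max0.
apply: (continuous_Rintegral_upto_ge0 (b := fun p => Num.max (a p) 0)) => // p.
  by rewrite le_max lexx orbT.
by apply: continuous_max; [exact: ca|exact: cst_continuous].
Qed.

Lemma continuous_mxP (T : topologicalType) m n (f : T -> 'M[R]_(m, n)) :
  (forall i j, continuous (fun p => f p i j)) -> continuous f.
Proof.
move=> cf p; rewrite (_ : f = fun p => \sum_i \sum_j f p i j *: delta_mx i j); last first.
  by apply/funext => q; exact: matrix_sum_delta.
apply: continuous_big => [|i _]; first exact: add_continuous.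
apply: continuous_big => [|j _]; first exact: add_continuous.
move=> q; apply: cvgZr_tmp; exact: cf.
Qed.

Lemma continuous_row_mx (T : topologicalType) n (t : T -> R) (y : T -> 'rV[R]_n) :
  continuous t -> continuous y ->
  continuous (fun p => row_mx (t p)%:M (y p) : 'rV_(1 + n)).
Proof.
move=> ct cy; apply: continuous_mxP => i j; case: (split_ordP j) => j' ->.
  by under eq_fun do rewrite row_mxEl mxE !ord1 eqxx mulr1n.
under eq_fun do rewrite row_mxEr.
exact: (continuous_compose cy (@coord_continuous _ _ _ i j')).
Qed.

(** The parameter space is arbitrary because each inner integral has the outer
integration variables among its parameters. *)
Lemma continuous_simplex_integral n (T : topologicalType) (a : T -> R)
    (f : T * 'rV[R]_n -> R) :
  continuous a -> continuous f ->
  continuous (fun p => simplex_integral (a p) (fun y => f (p, y))).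
Proof.
elim: n T a f => [|n IH] T a f ca cf /=.
  apply: (continuous_compose (f := fun p => (p, 0 : 'rV[R]_0))) cf.
  by apply: continuous_pair => x; [exact: cvg_id|exact: cst_continuous].
pose K (q : T * R) := simplex_integral (a q.1 - q.2)
  (fun y : 'rV_n => f (q.1, row_mx q.2%:M y : 'rV_(1 + n))).
apply: (continuous_Rintegral_upto (K := K)) => //.
pose g (z : (T * R) * 'rV[R]_n) := f (z.1.1, row_mx z.1.2%:M z.2 : 'rV_(1 + n)).
apply: (IH _ (fun q : T * R => a q.1 - q.2) g).
  move=> q; apply: continuousB; last exact: continuous_snd.
  exact: (continuous_compose (@continuous_fst _ _) ca).
apply: (continuous_compose
  (f := fun z : (T * R) * 'rV[R]_n => (z.1.1, row_mx z.1.2%:M z.2 : 'rV_(1 + n)))) cf.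
apply: continuous_pair; first exact: (continuous_compose (@continuous_fst _ _) (@continuous_fst _ _)).
apply: continuous_row_mx => /=; last exact: continuous_snd.
exact: (continuous_compose (@continuous_fst _ _) (@continuous_snd _ _)).
Qed.

Lemma continuous_simplex_slice n (a : R) (f : 'rV[R]_(1 + n) -> R) : continuous f ->
  continuous (fun t : R => simplex_integral (a - t) (fun y : 'rV_n => f (row_mx t%:M y))).
Proof.
move=> cf.
pose g (z : R * 'rV[R]_n) := f (row_mx z.1%:M z.2 : 'rV_(1 + n)).
apply: (@continuous_simplex_integral n _ (fun t => a - t) g).
  by move=> t; apply: continuousB; [exact: cst_continuous|exact: cvg_id].
apply: (continuous_compose (f := fun z : R * 'rV[R]_n => (row_mx z.1%:M z.2 : 'rV_(1 + n)))) cf.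
by apply: continuous_row_mx => z; [exact: continuous_fst|exact: continuous_snd].
Qed.

(** Continuity of the inner integrals makes every outer integrand integrable,
without which the integral would not be additive. *)
Lemma simplex_integralB n (a : R) (f g : 'rV[R]_n -> R) :
  continuous f -> continuous g ->
  simplex_integral a (fun y => f y - g y) = simplex_integral a f - simplex_integral a g.
Proof.
elim: n a f g => [//|n IH] a f g cf cg /=.
rewrite -RintegralB//; [|exact/continuous_integrable/continuous_simplex_slice..].
apply: eq_Rintegral => t _; rewrite (IH _ (fun y => f (row_mx t%:M y)) (fun y => g (row_mx t%:M y)))//.
  by apply: continuous_compose cf; apply: continuous_row_mx => y; [exact: cst_continuous|exact: cvg_id].
by apply: continuous_compose cg; apply: continuous_row_mx => y; [exact: cst_continuous|exact: cvg_id].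
Qed.

(** The iterated integral only sees values on the closed simplex. *)
Lemma eq_simplex_integral n (a : R) (f g : 'rV[R]_n -> R) :
  (forall y : 'rV_n, (forall i, 0 <= y 0 i) -> \sum_i y 0 i <= a -> f y = g y) ->
  0 <= a -> simplex_integral a f = simplex_integral a g.
Proof.
elim: n a f g => [|n IH] a f g fg a0 /=.
  by apply: fg => [[]//|]; rewrite big_ord0.
apply: eq_Rintegral => t; rewrite inE /= in_itv /= => /andP[t0 ta].
apply: IH; last by rewrite subr_ge0.
move=> y y0 ya; apply: fg.
  move=> i; case: (@split_ordP 1 n i) => j ->.
    by rewrite (row_mxEl _ _ 0 j) ord1 mxE eqxx.
  by have := y0 j; rewrite -(row_mxEr t%:M y 0 j).
rewrite (@big_split_ord _ _ _ 1 n) /= big_ord1.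
rewrite (_ : \sum_(i < n) _ = \sum_i y 0 i).
  rewrite (_ : _ 0 _ = t) 1?addrC -?lerBrDr//.
  by apply: etrans (row_mxEl _ _ 0 0) _; rewrite mxE eqxx.
by apply: eq_bigr => i _; exact: row_mxEr.
Qed.

End IteratedIntegral.

(** * Integrals of differential forms over smooth chains *)

Section SmoothTrig.
Context {R : realType}.

Lemma derive_comp_real m (phi : R -> R) (f : 'rV[R]_m -> R) (x v : 'rV[R]_m) (d : R) :
  differentiable f x -> is_derive (f x) 1 phi d ->
  differentiable (phi \o f) x /\ 'D_v (phi \o f) x = d * 'D_v f x.
Proof.
move=> df [dphi dE].
have dphi' : differentiable phi (f x) by exact/derivable1_diffP.
split; first exact: differentiable_comp.
rewrite deriveE; last exact: differentiable_comp.
rewrite diff_comp//= deriveE//.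
have -> : 'd f x v = 'd f x v *: (1 : R^o) by rewrite /GRing.scale /= mulr1.
have dE' : 'd phi (f x) 1 = d by rewrite -deriveE.
by rewrite linearZ /= dE' mulrC /GRing.scale /= mulr1.
Qed.

Lemma times_diff_trig k m (f : 'rV[R]_m -> R) : times_diff k f ->
  times_diff k (sin \o f) /\ times_diff k (cos \o f).
Proof.
elim: k f => [//|k IH] f Hf; have [sf cf] := IH _ (times_diffW Hf).
have [df dDf] := Hf; split; split=> [x|v].
- by have [] := derive_comp_real 0 (df x) (is_derive_sin (f x)).
- rewrite (_ : (fun x => _) = fun x => (cos \o f) x * 'D_v f x).
    by apply: times_diffM => //; exact: dDf.
  by apply/funext => x; have [_] := derive_comp_real v (df x) (is_derive_sin (f x)).
- by have [] := derive_comp_real 0 (df x) (is_derive_cos (f x)).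
- rewrite (_ : (fun x => _) = fun x => (-1) * ((sin \o f) x * 'D_v f x)).
    apply: times_diffM; first exact: times_diff_cst.
    by apply: times_diffM => //; exact: dDf.
  apply/funext => x; have [_ ->] := derive_comp_real v (df x) (is_derive_cos (f x)).
  by rewrite mulN1r mulNr.
Qed.

Lemma smooth_sin_comp m (f : 'rV[R]_m -> R) : smooth f -> smooth (sin \o f).
Proof. by move=> sf k; have [] := times_diff_trig (sf k). Qed.

Lemma smooth_continuous m (W : normedModType R) (f : 'rV[R]_m -> W) :
  smooth f -> continuous f.
Proof. by move=> sf x; exact/differentiable_continuous/smooth_diff. Qed.

(** For small e > 0, a map of R^m into a small ball around x that is a local
diffeomorphism at 0.  It serves as a reparametrization that sees a plot only
near x. *)
Definition sin_chart m (x : 'rV[R]_m) (e : R) (y : 'rV[R]_m) : 'rV[R]_m :=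
  \row_i (x 0 i + e * sin (y 0 i)).

Lemma smooth_sin_chart m (x : 'rV[R]_m) e : smooth (sin_chart x e).
Proof.
apply: smooth_row => i; under eq_fun do rewrite mxE.
move=> k; apply: times_diffD; first exact: times_diff_cst.
apply: times_diffM; first exact: times_diff_cst.
exact: (smooth_sin_comp (@smooth_coord R m i)).
Qed.

Lemma sin_chart0 m (x : 'rV[R]_m) e : sin_chart x e 0 = x.
Proof. by apply/rowP => i; rewrite !mxE sin0 mulr0 addr0. Qed.

Lemma is_derive_affine_sin (a e : R) :
  is_derive (0 : R) 1 (fun t : R => a + e * sin t) e.
Proof.
have H1 : is_derive (0 : R) (1 : R) (cst a : R -> R) 0 by exact: is_derive_cst.
have H2 : is_derive (0 : R) (1 : R) (e *: (sin : R -> R)) (e *: cos 0).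
  by apply: is_deriveZ; exact: is_derive_sin.
apply: is_derive_eq (is_deriveD H1 H2) _.
by rewrite cos0 add0r /GRing.scale /= mulr1.
Qed.

Lemma derive_sin_chart m (x : 'rV[R]_m) e v : 'D_v (sin_chart x e) 0 = e *: v.
Proof.
apply/rowP => i; rewrite derive_coord; last exact/smooth_diff/smooth_sin_chart.
rewrite (_ : (fun y => _) = (fun t : R => x 0 i + e * sin t) \o (fun y : 'rV_m => y 0 i)); last first.
  by apply/funext => y; rewrite /= mxE.
have dc : differentiable (fun y : 'rV[R]_m => y 0 i) (0 : 'rV_m).
  exact/smooth_diff/smooth_coord.
have dphi : is_derive ((0 : 'rV[R]_m) 0 i) 1 (fun t : R => x 0 i + e * sin t) e.
  by rewrite mxE; exact: is_derive_affine_sin.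
have [_ ->] := derive_comp_real v dc dphi; rewrite mxE; congr (_ * _).
rewrite -derive_coord; last exact/smooth_diff/smooth_id.
by rewrite deriveE// diff_val.
Qed.

Lemma sin_chart_ball m (x : 'rV[R]_m) e y : 0 < e -> ball x e (sin_chart x (e / 2) y).
Proof.
move=> e0; split=> // i j; rewrite -ball_normE /ball_ /= mxE ord1 opprD addNKr normrN normrM.
rewrite gtr0_norm ?divr_gt0//.
apply: (@le_lt_trans _ _ (e / 2)); last by rewrite ltr_pdivrMr// ltr_pMr// ltr1n.
by rewrite ler_piMr ?sin_max// divr_ge0// ltW.
Qed.

End SmoothTrig.

Section FormValues.
Context {R : realType}.
Implicit Types X Y : @smoothSpace R.

Lemma plot_eq X m (p q : plot X m) : (forall x, p x = q x) -> p = q.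
Proof.
case: p q => [p pp] [q pq] /= /funext E; case: q / E pq => pq.
by congr Plot; exact: Prop_irrelevance.
Qed.

(** After composition with a chart that maps R^m into the ball where p and q
agree, the two plots are equal; as the chart is invertible to first order at 0,
naturality recovers the values of w. *)
Lemma form_local X n (W : normedModType R) (w : rform X n W) m (p q : plot X m)
    (x : 'rV[R]_m) v :
  is_form w -> (\forall y \near x, p y = q y) -> w m p x v = w m q x v.
Proof.
move=> fw /nbhs_ballP[e /= e0 pq].
have sg := smooth_sin_chart x (e / 2).
have E : plot_comp p sg = plot_comp q sg.
  by apply: plot_eq => y /=; apply: pq; exact: sin_chart_ball.
have e20 : e / 2 != 0 by rewrite gt_eqF// divr_gt0.
have dg : (fun i => 'D_((e / 2)^-1 *: v i) (sin_chart x (e / 2)) 0) = v.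
  by apply/funext => i; rewrite derive_sin_chart scalerA divff// scale1r.
have := form_natural fw p sg 0 (fun i => (e / 2)^-1 *: v i).
have := form_natural fw q sg 0 (fun i => (e / 2)^-1 *: v i).
by rewrite E sin_chart0 dg => -> ->.
Qed.

Definition open_simplex n : set 'rV[R]_n :=
  [set y | (forall i, 0 < y 0 i) /\ \sum_i y 0 i < 1].

Lemma continuous_sum_coord n : continuous (fun y : 'rV[R]_n => \sum_i y 0 i).
Proof.
apply: continuous_big => [|i _]; first exact: add_continuous.
exact: coord_continuous.
Qed.

Lemma open_simplex_near n (x : 'rV[R]_n) :
  open_simplex x -> \forall y \near x, open_simplex y.
Proof.
move=> [x0 x1]; apply: filterI.
  apply: (@filter_forall _ _ (fun i (y : 'rV[R]_n) => 0 < y 0 i) (nbhs x)) => i.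
  exact: (cvgr_gt _ (@coord_continuous _ _ _ 0 i x)).
exact: (cvgr_lt _ (@continuous_sum_coord n x)).
Qed.

Lemma bary_in n (y : 'rV[R]_n) :
  (forall i, 0 <= y 0 i) -> \sum_i y 0 i <= 1 -> in_simplex (bary y).
Proof.
move=> y0 y1; have b0 : bary y 0 (@lshift 1 n 0) = 1 - \sum_i y 0 i.
  by apply: etrans (row_mxEl _ _ 0 0) _; rewrite mxE eqxx.
have bS i : bary y 0 (@rshift 1 n i) = y 0 i by exact: row_mxEr.
apply/andP; split.
  apply/forallP => i; case: (@split_ordP 1 n i) => j ->; last by rewrite bS.
  by rewrite ord1 b0 subr_ge0.
rewrite (@big_split_ord _ _ _ 1 n) /= big_ord1.
by rewrite b0; under eq_bigr do rewrite bS; rewrite subrK.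
Qed.

(** Every point of the closed simplex is the end of a segment from an interior
point, so a continuous function vanishing inside vanishes everywhere. *)
Lemma open_simplex_dense n (f : 'rV[R]_n -> R) (x : 'rV[R]_n) :
  continuous f -> (forall y, open_simplex y -> f y = 0) ->
  (forall i, 0 <= x 0 i) -> \sum_i x 0 i <= 1 -> f x = 0.
Proof.
move=> cf f0 x0 x1; apply: contrapT => fx.
(* b is the barycentre, and c moves from x towards b. *)
pose b : 'rV[R]_n := const_mx n.+1%:R^-1.
pose c (s : R) : 'rV[R]_n := (1 - s) *: x + s *: b.
have cc : continuous c.
  move=> s; apply: cvgD; apply: cvgZr_tmp; last exact: cvg_id.
  by apply: cvgB; [exact: cvg_cst|exact: cvg_id].
have c0 : c 0 = x by rewrite /c subr0 scale1r scale0r addr0.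
have nz : \forall s \near (0 : R), f (c s) != 0.
  have : f (c s) @[s --> (0 : R)] --> f x.
    by rewrite -c0; exact: (continuous_compose cc cf).
  move=> /cvgrPdist_lt/(_ `|f x|); rewrite normr_gt0.
  move/eqP : (fx) => fx' /(_ fx'); apply: filterS => s.
  by apply: contraTneq => ->; rewrite subr0 ltxx.
have /nbhs_ballP[d /= d0 Hd] := nz.
pose s := Num.min (d / 2) (1 / 2).
have s0 : 0 < s by rewrite lt_min !divr_gt0.
have s1 : s < 1 by rewrite gt_min; apply/orP; right; lra.
have sd : s < d by rewrite gt_min; apply/orP; left; lra.
have sB : ball (0 : R) d s by rewrite -ball_normE /ball_ /= sub0r normrN gtr0_norm.
have /eqP := Hd s sB; apply.
have b0 : 0 < n.+1%:R^-1 :> R by rewrite invr_gt0.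
apply: f0; split=> [i|].
  rewrite /c !mxE; apply: ltr_wpDl; last exact: mulr_gt0.
  by rewrite mulr_ge0// subr_ge0 ltW.
have -> : \sum_i c s 0 i = (1 - s) * (\sum_i x 0 i) + s * (n.+1%:R^-1 * n%:R).
  under eq_bigr do rewrite /c !mxE.
  by rewrite big_split/= -!mulr_sumr sumr_const card_ord mulr_natr.
have nn : n.+1%:R^-1 * n%:R < 1 :> R.
  by rewrite mulrC ltr_pdivrMr// mul1r ltr_nat.
have h1 : s * (n.+1%:R^-1 * n%:R) < s by rewrite gtr_pMr.
have h2 : (1 - s) * (\sum_i x 0 i) <= 1 - s by rewrite ler_piMr// subr_ge0 ltW.
by have := ler_ltD h2 h1; rewrite subrK.
Qed.

(** Independence of the extension: two extensions agree near each interior point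
of the simplex, so the integrands agree there, and by continuity up to the
boundary. *)
Lemma int_simplexE X n (w : rform X n R) (s : simplex X n) (p : plot X n.+1) :
  is_form w -> (forall x, s x = p (sval x)) ->
  int_simplex w s = simplex_integral 1 (fun t =>
    w n (plot_comp p (@smooth_bary R n)) t (fun i => delta_mx 0 i)).
Proof.
move=> fw sp; apply: eq_simplex_integral => // y y0 y1.
set q := simplex_ext s; have sq x : s x = q (sval x).
  by rewrite /q /simplex_ext; case: cid.
have pq (z : 'rV[R]_n) : (forall i, 0 <= z 0 i) -> \sum_i z 0 i <= 1 -> q (bary z) = p (bary z).
  move=> z0 z1; pose zz : std_simplex n := exist _ (bary z) (bary_in z0 z1).
  by have := sq zz; rewrite sp.
apply/eqP; rewrite -subr_eq0; apply/eqP.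
apply: (@open_simplex_dense n (fun t =>
  w n (plot_comp q (@smooth_bary R n)) t (fun i => delta_mx 0 i) -
  w n (plot_comp p (@smooth_bary R n)) t (fun i => delta_mx 0 i))) => //.
  by move=> t; apply: continuousB; exact/smooth_continuous/form_smooth.
move=> z /open_simplex_near zn; apply/eqP; rewrite subr_eq0; apply/eqP.
apply: form_local => //; apply: filterS zn => t [t0 t1] /=.
by apply: pq => [i|]; exact: ltW.
Qed.

(** The push-forward of an extension of s extends the push-forward of s. *)
Lemma int_chain_push X Y (f : smap X Y) n (w : rform Y n R) (c : schain X n) :
  is_form w -> int_chain w (push_chain f c) = int_chain (pull_form f w) c.
Proof.
move=> fw; apply: (@eq_additive_chain _ X n _
  (lin_ext (int_simplex w) \o @push_chain _ X Y f n)
  (lin_ext (int_simplex (pull_form f w)))) => s /=.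
rewrite /push_chain !lin_extU.
rewrite (@int_simplexE _ _ _ _ (smap_plot f (simplex_ext s)))//; last first.
  by move=> x /=; rewrite /simplex_ext; case: cid => p /= <-.
congr (simplex_integral _ _); apply/funext => t; rewrite /pull_form.
by congr (w n _ t _); exact: plot_eq.
Qed.

Lemma pull_form_is_form X Y (f : smap X Y) n (W : normedModType R) (w : rform Y n W) :
  is_form w -> is_form (pull_form f w).
Proof.
move=> [sw lw aw nw]; split; rewrite /pull_form.
- by move=> m p v; exact: sw.
- by move=> m p; exact: lw.
- by move=> m p; exact: aw.
- move=> l m p g sg x v; rewrite -nw; congr (w _ _ x v); exact: plot_eq.
Qed.

Definition sub_form X n (w w' : rform X n R) : rform X n R :=
  fun m p x v => w m p x v - w' m p x v.

Lemma sub_form_is_form X n (w w' : rform X n R) :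
  is_form w -> is_form w' -> is_form (sub_form w w').
Proof.
move=> fw fw'; split; rewrite /sub_form.
- move=> m p v; under eq_fun do rewrite -[- w' _ _ _ _]mulN1r.
  move=> k; apply: times_diffD; first exact: (form_smooth fw).
  by apply: times_diffM; [exact: times_diff_cst|exact: (form_smooth fw')].
- move=> m p x v i a u u'; rewrite (form_linear fw) (form_linear fw') scalerBr.
  by rewrite opprD addrACA.
- move=> m p x v i j ij vij.
  by rewrite (form_alternating fw _ _ ij vij) (form_alternating fw' _ _ ij vij) subrr.
- by move=> l m p g sg x v; rewrite (form_natural fw) (form_natural fw').
Qed.

Lemma int_chainB X n (w w' : rform X n R) (c : schain X n) :
  is_form w -> is_form w' ->
  int_chain (sub_form w w') c = int_chain w c - int_chain w' c.
Proof.
move=> fw fw'.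
apply: (@eq_additive_chain _ X n _ (lin_ext (int_simplex (sub_form w w')))
  (lin_ext (int_simplex w) \- lin_ext (int_simplex w'))) => s /=.
rewrite !lin_extU; apply: simplex_integralB;
  by apply: smooth_continuous; exact: form_smooth.
Qed.

Lemma zero_form_is_form X n : is_form (@zero_form R X n R).
Proof.
split; rewrite /zero_form => //.
- by move=> m p v; exact: smooth_cst.
- by move=> *; rewrite scaler0 addr0.
Qed.

Lemma int_chain0 X n (c : schain X n) : int_chain (@zero_form R X n R) c = 0.
Proof.
have z := @zero_form_is_form X n.
have <- : sub_form (@zero_form R X n R) (@zero_form R X n R) = @zero_form R X n R.
  by do 4![apply: functional_extensionality_dep => ?]; rewrite /sub_form subrr.
by rewrite int_chainB// subrr.
Qed.

End FormValues.

(** * Paths in the circle *)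

Section CirclePaths.
Context {R : realType}.
Notation mu := (@lebesgue_measure R).

(** The primitive is taken from -1 so that it is differentiable at 0 as well. *)
Lemma continuous_primitive (a : R -> R) : continuous a ->
  exists A : R -> R, (forall x : R, 0 <= x <= 1 -> is_derive x 1 A (a x)) /\
    \int[mu]_(t in `[0, 1]) a t = A 1 - A 0.
Proof.
move=> ca; exists (fun x => \int[mu]_(t in `[-1, x]) a t); split.
  move=> x /andP[x0 x1].
  have [||||dA EA] := @continuous_FTC1 R a (BLeft (-1)) x 2.
  - by lra.
  - exact: continuous_integrable.
  - by rewrite /Order.lt /= ; lra.
  - exact: ca.
  by apply: DeriveDef; rewrite -?derive1E.
have i1 := continuous_integrable (-1) 1 ca.
rewrite Rintegral_itvB ?bnd_simp//.
rewrite Rintegral_itv_obnd_cbnd//.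
by apply: integrableS i1 => //; apply: subset_itvr; rewrite bnd_simp; lra.
Qed.

Lemma eq_of_derive0 (f : R -> R) :
  (forall x : R, 0 <= x <= 1 -> is_derive x 1 f 0) -> f 0 = f 1.
Proof.
move=> df; have [||c _] := @MVT_segment R f (fun=> 0) 0 1 ler01.
- by move=> x; rewrite in_itv /= => /andP[x0 x1]; apply: df; rewrite !ltW.
- apply/continuous_within_itvP => //.
  have cf x : 0 <= x <= 1 -> {for x, continuous f}.
    by move=> /df[dfx _]; apply: differentiable_continuous; exact/derivable1_diffP.
  split.
  + by move=> x; rewrite in_itv /= => /andP[x0 x1]; apply: cf; rewrite !ltW.
  + by apply: cvg_at_right_filter; apply: cf; rewrite lexx ler01.
  + by apply: cvg_at_left_filter; apply: cf; rewrite lexx ler01.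
- by rewrite mul0r => /eqP; rewrite subr_eq0 => /eqP.
Qed.

Lemma circle_eqP (z w : circle R) :
  complex.Re (val z) = complex.Re (val w) ->
  complex.Im (val z) = complex.Im (val w) -> z = w.
Proof. by move=> r i; apply/val_inj/eqP; rewrite eq_complex r i !eqxx. Qed.

Lemma Re_circleD (z w : circle R) : complex.Re (val (z + w)) =
  complex.Re (val z) * complex.Re (val w) - complex.Im (val z) * complex.Im (val w).
Proof. by case: z w => -[? ?] ? [[? ?] ?]. Qed.

Lemma Im_circleD (z w : circle R) : complex.Im (val (z + w)) =
  complex.Re (val z) * complex.Im (val w) + complex.Im (val z) * complex.Re (val w).
Proof. by case: z w => -[? ?] ? [[? ?] ?]. Qed.

(** The path exp(2 pi i A) for a primitive A of a has the same logarithmic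
derivative as z, so their quotient has derivative zero. *)
Lemma circle_path_lift (z : R -> circle R) (a x' y' : R -> R) :
  (forall t : R, is_derive t 1 (fun t => complex.Re (val (z t))) (x' t)) ->
  (forall t : R, is_derive t 1 (fun t => complex.Im (val (z t))) (y' t)) ->
  (forall t, 2 * pi * a t =
    complex.Re (val (z t)) * y' t - complex.Im (val (z t)) * x' t) ->
  continuous a -> z 1 - z 0 = expi (\int[mu]_(t in `[0, 1]) a t).
Proof.
move=> dx dy aE ca; have [A [dA ->]] := continuous_primitive ca.
set x := fun t => complex.Re (val (z t)) in dx; set y := fun t => complex.Im (val (z t)) in dy.
have xy1 t : x t ^+ 2 + y t ^+ 2 = 1 by exact: circle_sqr.
have xy' t : x t * x' t + y t * y' t = 0.
  have := is_deriveD (is_deriveM (dx t) (dx t)) (is_deriveM (dy t) (dy t)).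
  rewrite [X in is_derive _ _ X](_ : _ = cst 1); last first.
    by apply/funext => s; rewrite !fctE -[RHS](xy1 s) !expr2.
  move=> [_]; rewrite derive_cst /GRing.scale /= -/(x t) -/(y t) => E; lra.
(* It remains to see that the quotient z(t) exp(- 2 pi i A(t)) has the same value
   at 0 and at 1. *)
suff C : z 1 - expi (A 1) = z 0 - expi (A 0).
  rewrite expiD expiN; apply/eqP; rewrite -subr_eq0 opprB [X in _ + X]addrC.
  by rewrite addrACA C addrACA subrr addNr addr0.
pose c t := cos (2 * pi * A t); pose s t := sin (2 * pi * A t).
have dcs (t : R) : 0 <= t <= 1 -> is_derive t 1 c (- s t * (2 * pi * a t)) /\
    is_derive t 1 s (c t * (2 * pi * a t)).
  move=> t01; have d2 : is_derive t 1 ((2 * pi) *: A) (2 * pi * a t).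
    by apply: is_deriveZ; exact: dA.
  by split; apply: is_derive1_comp.
have Re_E t : complex.Re (val (z t - expi (A t))) = x t * c t + y t * s t.
  by rewrite -expiN Re_circleD /= mulrN cosN sinN mulrN opprK.
have Im_E t : complex.Im (val (z t - expi (A t))) = y t * c t - x t * s t.
  by rewrite -expiN Im_circleD /= mulrN cosN sinN mulrN addrC.
apply: circle_eqP; rewrite ?Re_E ?Im_E; symmetry.
- apply: (@eq_of_derive0 (fun t => x t * c t + y t * s t)) => t t01.
  have [dc ds] := dcs t t01.
  apply: is_derive_eq (is_deriveD (is_deriveM (dx t) dc) (is_deriveM (dy t) ds)) _.
  rewrite /GRing.scale /= (aE t) -/(x t) -/(y t).
  move: (xy1 t) (xy' t); move: (x t) (y t) (x' t) (y' t) (c t) (s t) => X Y X' Y' C S N H.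
  (* The derivative is a combination of x x' + y y' = 0 and 1 - x^2 - y^2 = 0. *)
  transitivity (C * (X * (X * X' + Y * Y') + X' * (1 - (X ^+ 2 + Y ^+ 2))) +
    S * (Y * (X * X' + Y * Y') + Y' * (1 - (X ^+ 2 + Y ^+ 2)))); first by ring.
  by rewrite H N; ring.
- apply: (@eq_of_derive0 (fun t => y t * c t - x t * s t)) => t t01.
  have [dc ds] := dcs t t01.
  apply: is_derive_eq (is_deriveB (is_deriveM (dy t) dc) (is_deriveM (dx t) ds)) _.
  rewrite /GRing.scale /= (aE t) -/(x t) -/(y t).
  move: (xy1 t) (xy' t); move: (x t) (y t) (x' t) (y' t) (c t) (s t) => X Y X' Y' C S N H.
  transitivity (C * (Y * (X * X' + Y * Y') + Y' * (1 - (X ^+ 2 + Y ^+ 2))) -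
    S * (X * (X * X' + Y * Y') + X' * (1 - (X ^+ 2 + Y ^+ 2)))); first by ring.
  by rewrite H N; ring.
Qed.

End CirclePaths.

(** * Integrals over 1-simplices *)

Section ChainMorphisms.
Context {R : realType}.
Implicit Types X : @smoothSpace R.

Lemma eq_chain_morphism X n (M : zmodType) (F G : schain X n -> M) :
  zmod_morphism F -> zmod_morphism G ->
  (forall s, F << s >> = G << s >>) -> F =1 G.
Proof.
move=> zF zG FG.
pose F' : {additive schain X n -> M} := HB.pack F (GRing.isZmodMorphism.Build _ _ F zF).
pose G' : {additive schain X n -> M} := HB.pack G (GRing.isZmodMorphism.Build _ _ G zG).
exact: (@eq_additive_chain _ X n M F' G').
Qed.

Lemma bd_cycB X n (c c' : schain X n) : bd_cyc (c - c') = bd_cyc c - bd_cyc c'.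
Proof. by apply/val_inj; rewrite /= raddfB. Qed.

Lemma int_chain_morphism X n (w : rform X n R) : zmod_morphism (int_chain w).
Proof. exact: lin_ext_additive. Qed.

(** Both sides are homomorphisms on the free group of chains. *)
Lemma has_curv_simplex X n (h : cyc X n.-1 -> circle R) (w : rform X n R) :
  zmod_morphism h ->
  (forall s, h (bd_cyc << s >>) = expi (int_simplex w s)) -> has_curv h w.
Proof.
move=> zh hs; apply: eq_chain_morphism => [c c'|c c'|s].
- by rewrite bd_cycB zh.
- by rewrite int_chain_morphism expiB.
- by rewrite hs /int_chain lin_extU.
Qed.

Lemma bary1 (t : R) : bary (const_mx t : 'rV_1) = \row_j (if j == 0 then 1 - t else t).
Proof.
apply/rowP => j; rewrite [RHS]mxE; case: (@split_ordP 1 1 j) => i ->.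
  rewrite ord1 (_ : (_ == 0) = true)//.
  by apply: etrans (row_mxEl _ _ 0 0) _; rewrite mxE eqxx big_ord1 mxE.
rewrite (_ : (_ == 0) = false)//.
by apply: etrans (row_mxEr _ _ 0 i) _; rewrite mxE.
Qed.

(** The face opposite to vertex 0 is the end point and enters with sign +1, the
face opposite to vertex 1 is the starting point. *)
Lemma bd_simplex1 X (s : simplex X 1) (p : plot X 2) :
  (forall x, s x = p (sval x)) ->
  bd_cyc << s >> = point_cyc (p (bary (const_mx 1))) - point_cyc (p (bary (const_mx 0))).
Proof.
move=> sp; apply/val_inj; rewrite /= lin_extU big_ord_recl big_ord1 /=.
have face i t : (forall x, in_simplex x -> face_map i x = bary (const_mx t)) ->
    simplex_face s i = const_simplex 0 (p (bary (const_mx t))).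
  move=> E; apply: simplex_eq => x /=; rewrite sp /= E//.
  exact: (svalP x).
rewrite (face _ 1) ?(face _ 0).
- by rewrite expr0 expr1 [X in _ + X]chainU mulrNz.
- move=> x /andP[_]; rewrite big_ord1 => /eqP x1.
  rewrite bary1; apply/rowP => j; rewrite !mxE; case: unliftP => [k|] ->.
    by rewrite ord1 x1 subr0.
  by rewrite /=.
- move=> x /andP[_]; rewrite big_ord1 => /eqP x1.
  rewrite bary1; apply/rowP => j; rewrite !mxE; case: unliftP => [k|] ->.
    by rewrite ord1 x1.
  by rewrite /= subrr.
Qed.

Lemma simplex_integral1 (f : 'rV[R]_1 -> R) :
  simplex_integral 1 f = \int[lebesgue_measure]_(t in `[0, 1]) f (const_mx t).
Proof.
rewrite /=; apply: eq_Rintegral => t _; congr (f _).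
apply/rowP => j; rewrite [RHS]mxE; case: (@split_ordP 1 0 j) => [i ->|[]//].
by apply: etrans (row_mxEl _ _ 0 i) _; rewrite ord1 mxE eqxx.
Qed.

Lemma continuous_const_mx m : continuous (fun t : R => const_mx t : 'rV[R]_m).
Proof.
by apply: continuous_mxP => i j; under eq_fun do rewrite mxE; move=> t; exact: cvg_id.
Qed.

Lemma delta_mx1 : (fun i : 'I_1 => delta_mx 0 i : 'rV[R]_1) = fun=> const_mx 1.
Proof. by apply/funext => i; apply/rowP => j; rewrite !mxE !ord1 eqxx. Qed.

Lemma is_derive_line (f : 'rV[R]_1 -> R) (t : R) : smooth f ->
  is_derive t 1 (fun t : R => f (const_mx t)) ('D_(const_mx 1) f (const_mx t)).
Proof.
move=> /(smooth_diff (const_mx t)) dft; have df := @diff_derivable _ _ _ _ _ (const_mx 1) dft.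
have E : (fun h : R => h^-1 *: (((fun t : R => f (const_mx t)) \o shift t) (h *: (1 : R)) - f (const_mx t))) =
    (fun h : R => h^-1 *: ((f \o shift (const_mx t)) (h *: const_mx 1) - f (const_mx t))).
  apply/funext => h; congr (_ *: (f _ - _)).
  by apply/rowP => j; rewrite !mxE.
by apply: DeriveDef; rewrite /derivable /derive E.
Qed.

End ChainMorphisms.

(** * Characters of degree 1 *)

Section LogDerivative.
Context {R : realType}.
Variables (X : @smoothSpace R) (h : cyc X 0 -> circle R).

Definition circle_fun (x : X) : circle R := h (point_cyc x).
Definition re_along m (p : plot X m) (x : 'rV[R]_m) : R := complex.Re (val (circle_fun (p x))).
Definition im_along m (p : plot X m) (x : 'rV[R]_m) : R := complex.Im (val (circle_fun (p x))).

(** The form dh / (2 pi i h): for h = x + i y with x^2 + y^2 = 1 this is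
(x dy - y dx) / (2 pi). *)
Definition dlog : rform X 1 R := fun m p x v =>
  (2 * pi)^-1 * (re_along p x * 'D_(v ord0) (im_along p) x
               - im_along p x * 'D_(v ord0) (re_along p) x).

Lemma smooth_derive m (f : 'rV[R]_m -> R) v : smooth f -> smooth (fun x => 'D_v f x).
Proof. by move=> sf k; have [_] := sf k.+1; apply. Qed.

Lemma smoothB m (f g : 'rV[R]_m -> R) : smooth f -> smooth g -> smooth (fun x => f x - g x).
Proof.
move=> sf sg k; under eq_fun do rewrite -[- g _]mulN1r.
by apply: times_diffD => //; apply: times_diffM => //; exact: times_diff_cst.
Qed.

Lemma smoothM m (f g : 'rV[R]_m -> R) : smooth f -> smooth g -> smooth (fun x => f x * g x).
Proof. by move=> sf sg k; exact: times_diffM. Qed.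

Lemma derive_comp_smooth l m (f : 'rV[R]_m -> R) (g : 'rV[R]_l -> 'rV[R]_m) x v :
  smooth f -> smooth g -> 'D_v (f \o g) x = 'D_('D_v g x) f (g x).
Proof.
move=> sf sg; have [df dg] := (smooth_diff (g x) sf, smooth_diff x sg).
rewrite deriveE; last exact: differentiable_comp.
by rewrite diff_comp//= !deriveE.
Qed.

Lemma derive_dir_linear m (f : 'rV[R]_m -> R) x a u v : differentiable f x ->
  'D_(a *: u + v) f x = a * 'D_u f x + 'D_v f x.
Proof. by move=> df; rewrite !deriveE// linearP. Qed.

Hypothesis hs : circle_smooth (fun x : X => h (point_cyc x)).

Lemma smooth_re m (p : plot X m) : smooth (re_along p).
Proof. by have [] := hs p. Qed.

Lemma smooth_im m (p : plot X m) : smooth (im_along p).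
Proof. by have [] := hs p. Qed.

Lemma dlog_is_form : is_form dlog.
Proof.
split; rewrite /dlog.
- move=> m p v; apply: smoothM; first exact: smooth_cst.
  by apply: smoothB; apply: smoothM; rewrite /=;
    [exact: smooth_re|exact/smooth_derive/smooth_im|exact: smooth_im|exact/smooth_derive/smooth_re].
- move=> m p x v i a u u'; rewrite !ord1 /=.
  have [dr di] := (smooth_diff x (@smooth_re m p), smooth_diff x (@smooth_im m p)).
  by rewrite !derive_dir_linear// -[RHS]/(a * _ + _); ring.
- by move=> m p x v i j; rewrite !ord1.
- move=> l m p g sg x v.
  have Er : re_along (plot_comp p sg) = re_along p \o g by [].
  have Ei : im_along (plot_comp p sg) = im_along p \o g by [].
  rewrite Er Ei !derive_comp_smooth//; [exact: smooth_re|exact: smooth_im].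
Qed.

Hypothesis hm : zmod_morphism h.

Lemma dlog_curv : has_curv (n := 1) h dlog.
Proof.
apply: has_curv_simplex => // s; set p := simplex_ext s.
have sp x : s x = p (sval x) by rewrite /p /simplex_ext; case: cid.
rewrite (bd_simplex1 sp) hm /int_simplex simplex_integral1 delta_mx1.
pose q := plot_comp p (@smooth_bary R 1).
pose z (t : R) := circle_fun (q (const_mx t)).
pose x' t := 'D_(const_mx 1) (re_along q) (const_mx t).
pose y' t := 'D_(const_mx 1) (im_along q) (const_mx t).
apply: (@circle_path_lift R z (fun t => dlog q (const_mx t) (fun=> const_mx 1)) x' y').
- by move=> t; apply: (@is_derive_line R (re_along q)); exact: smooth_re.
- by move=> t; apply: (@is_derive_line R (im_along q)); exact: smooth_im.
- move=> t; rewrite /dlog mulrA divff ?mul1r//.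
  by rewrite mulf_neq0 ?pnatr_eq0// gt_eqF// pi_gt0.
- apply: (continuous_compose (g := fun x => dlog q x (fun=> const_mx 1))
    (@continuous_const_mx R 1)).
  exact/smooth_continuous/(form_smooth dlog_is_form).
Qed.

End LogDerivative.

Section SmoothFromCurvature.
Context {R : realType}.
Notation mu := (@lebesgue_measure R).

Lemma derive_affine (U V : normedModType R) (f : U -> V) a u (d : V) :
  (forall s : R, f (s *: u + a) = s *: d + f a) -> 'D_u f a = d.
Proof.
move=> fa; rewrite /derive; apply: cvg_lim => //; apply: cvg_near_cst.
near=> s; rewrite /= fa addrK scalerA mulVf ?scale1r//.
by near: s; exact: nbhs_dnbhs_neq.
Unshelve. all: by end_near. Qed.

Lemma is_derive_rotation (a b : R) :
  is_derive (0 : R) 1 (fun s : R => a * cos (2 * pi * s) + b * sin (2 * pi * s)) (b * (2 * pi)).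
Proof.
have d2 : is_derive (0 : R) (1 : R) ((2 * pi) *: (@id R)) (2 * pi * 1) by apply: is_deriveZ.
have dc : is_derive (0 : R) (1 : R) (fun s : R => cos (2 * pi * s)) (- sin (2 * pi * 0) * (2 * pi * 1)).
  exact: (is_derive1_comp (is_derive_cos _) d2).
have ds : is_derive (0 : R) (1 : R) (fun s : R => sin (2 * pi * s)) (cos (2 * pi * 0) * (2 * pi * 1)).
  exact: (is_derive1_comp (is_derive_sin _) d2).
apply: is_derive_eq (is_deriveD (is_deriveZ a dc) (is_deriveZ b ds)) _.
by rewrite mulr0 sin0 cos0 oppr0 mul0r scaler0 add0r mul1r mulr1.
Qed.

Lemma coord_le_norm m (v : 'rV[R]_m) i : `|v 0 i| <= `|v|.
Proof.
rewrite leNgt; apply/negP => vi.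
have v0 : 0 < `|v 0 i| by exact: le_lt_trans vi.
have : ball (0 : 'rV[R]_m) `|v 0 i| v by rewrite -ball_normE /ball_ /= sub0r normrN.
by move=> [_ /(_ 0 i)]; rewrite -ball_normE /ball_ /= mxE sub0r normrN ltxx.
Qed.

(** The definition of the derivative without Landau notation. *)
Lemma differentiable_of_linear_approx m (F : 'rV[R]_m -> R) x
    (L : {linear 'rV[R]_m -> R^o}) : continuous L ->
  (forall e, 0 < e -> \forall v \near (0 : 'rV[R]_m), `|F (v + x) - F x - L v| <= e * `|v|) ->
  differentiable F x /\ forall v, 'D_v F x = L v.
Proof.
move=> cL FL.
have e0 : F \o shift x = cst (F x) + L +o_ (0 : 'rV[R]_m) id.
  apply/eqaddoP => e e0; apply: filterS (FL e e0) => v.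
  by rewrite !fctE /= /shift opprD addrA.
have dE := diff_unique cL e0.
have dF : differentiable F x by apply/diff_locallyP; rewrite dE.
by split=> // v; rewrite deriveE// dE.
Qed.

Variables (X : @smoothSpace R) (w : rform X 1 R).
Hypothesis fw : is_form w.

Definition form_at m (p : plot X m) (x v : 'rV[R]_m) : R := w p x (fun=> v).

Lemma form_at_is_linear m (p : plot X m) (x : 'rV[R]_m) :
  linear (form_at p x : 'rV[R]_m -> R^o).
Proof.
move=> a u v; have := form_linear fw p x (fun=> 0) ord0 a u v.
have E (y : 'rV[R]_m) : w p x [eta (fun=> 0) with ord0 |-> y] = form_at p x y.
  by congr (w p x _); apply/funext => i; rewrite /= ord1 eqxx.
by rewrite !E.
Qed.

Lemma form_atE m (p : plot X m) (x v : 'rV[R]_m) :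
  form_at p x v = \sum_i v 0 i * form_at p x (delta_mx 0 i).
Proof.
pose lM := GRing.isLinear.Build _ _ _ _ _ (form_at_is_linear p x).
pose L : {linear 'rV[R]_m -> R^o} := HB.pack (form_at p x : 'rV[R]_m -> R^o) lM.
rewrite -[LHS]/(L v) {1}(row_sum_delta v) linear_sum; apply: eq_bigr => i _.
by rewrite linearZ.
Qed.

Lemma continuous_form_at m (p : plot X m) (x : 'rV[R]_m) : continuous (form_at p x).
Proof.
rewrite (funext (form_atE p x)); apply: continuous_big => [|i _]; first exact: add_continuous.
move=> v; apply: (@continuousM _ _ (fun v : 'rV[R]_m => v 0 i) (fun=> form_at p x _)).
  exact: coord_continuous.
exact: cst_continuous.
Qed.

Definition segment_integral m (p : plot X m) (x v : 'rV[R]_m) : R :=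
  \int[mu]_(t in `[0, 1]) form_at p (x + t *: v) v.

Lemma continuous_segment m (p : plot X m) (x v : 'rV[R]_m) :
  continuous (fun t : R => form_at p (x + t *: v) v).
Proof.
apply: (continuous_compose (f := fun t : R => x + t *: v) (g := fun y => form_at p y v)).
  by move=> t; apply: cvgD; [exact: cvg_cst|apply: cvgZr_tmp; exact: cvg_id].
exact/smooth_continuous/(form_smooth fw).
Qed.

Lemma segment_integral0 m (p : plot X m) (x : 'rV[R]_m) : segment_integral p x 0 = 0.
Proof.
rewrite /segment_integral (_ : (fun t => _) = fun=> 0) ?Rintegral_cst ?mul0r//.
apply/funext => t; rewrite scaler0 addr0 form_atE big1// => i _.
by rewrite mxE mul0r.
Qed.

(** Reduces to the finitely many continuous coefficients of the form; the factor
m + 1 in e1 pays for the sum over them. *)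
Lemma form_at_near m (p : plot X m) (x : 'rV[R]_m) e : 0 < e ->
  \forall v \near (0 : 'rV[R]_m), forall t, 0 <= t <= 1 ->
    `|form_at p (x + t *: v) v - form_at p x v| <= e * `|v|.
Proof.
move=> e0; pose e1 := e / m.+1%:R; have e10 : 0 < e1 by rewrite divr_gt0.
have : \forall y \near x, forall i,
    `|form_at p x (delta_mx 0 i) - form_at p y (delta_mx 0 i)| < e1.
  apply: (@filter_forall _ _ (fun i y => `|form_at p x (delta_mx 0 i) - form_at p y (delta_mx 0 i)| < e1) (nbhs x)) => i.
  have ci : continuous (fun y => form_at p y (delta_mx 0 i)).
    exact/smooth_continuous/(form_smooth fw).
  by have /cvgrPdist_lt := ci x; apply.
move=> /nbhs_ballP[d /= d0 Hd]; apply/nbhs_ballP; exists d => //= v.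
rewrite -ball_normE /ball_ /= sub0r normrN => vd t /andP[t0 t1].
have Hx : forall i, `|form_at p x (delta_mx 0 i) - form_at p (x + t *: v) (delta_mx 0 i)| < e1.
  apply: Hd; rewrite -ball_normE /ball_ /= opprD addNKr normrN normrZ.
  by apply: le_lt_trans vd; rewrite ler_piMl// ger0_norm.
rewrite !(form_atE p _ v) -sumrB.
apply: le_trans (ler_norm_sum _ _ _) _.
apply: le_trans (_ : \sum_(i < m) e1 * `|v| <= _).
  apply: ler_sum => i _; rewrite -mulrBr normrM mulrC ler_pM//; last exact: coord_le_norm.
  by rewrite distrC ltW.
rewrite sumr_const card_ord -mulr_natr mulrAC ler_wpM2r//.
by rewrite /e1 mulrAC ler_pdivrMr// ler_pM2l// ler_nat.
Qed.

(** The integral from x to y is the value of the form at x on y - x up to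
o(y - x), because the coefficients of the form are continuous at x. *)
Lemma segment_integral_diff m (p : plot X m) (x : 'rV[R]_m) :
  differentiable (fun y => segment_integral p x (y - x)) x /\
  forall v, 'D_v (fun y => segment_integral p x (y - x)) x = form_at p x v.
Proof.
pose lM := GRing.isLinear.Build _ _ _ _ _ (form_at_is_linear p x).
pose L : {linear 'rV[R]_m -> R^o} := HB.pack (form_at p x : 'rV[R]_m -> R^o) lM.
apply: (@differentiable_of_linear_approx _ _ _ L); first exact: continuous_form_at.
move=> e e0; apply: filterS (form_at_near p x e0) => v Hv.
rewrite addrK subrr segment_integral0 subr0 -[L v]/(form_at p x v).
have -> : form_at p x v = \int[mu]_(t in `[0, 1]) form_at p x v.
  by rewrite Rintegral_cst//= lebesgue_measure_itv /= lte_fin ltr01 /= subr0 mulr1.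
rewrite /segment_integral -RintegralB//; last 2 first.
- exact/continuous_integrable/continuous_segment.
- exact/continuous_integrable/cst_continuous.
have := @normr_Rintegral_le R 0 1 (e * `|v|) (fun t => form_at p (x + t *: v) v - form_at p x v).
rewrite subr0 mulr1; apply=> //.
by move=> t; exact: (cvgB (@continuous_segment m p x v t) (cvg_cst _)).
Qed.

Variable h : cyc X 0 -> circle R.
Hypotheses (hm : zmod_morphism h) (hw : has_curv (n := 1) h w).

Lemma smooth_segment m (x v : 'rV[R]_m) : smooth (fun y : 'rV[R]_2 => x + y 0 1 *: v).
Proof.
move=> k; apply: times_diffD; first exact: times_diff_cst.
by apply: times_diffZ; exact: smooth_coord.
Qed.

(** The straight segment from x to x + v, parametrized affinely, is a 1-simplex
whose boundary computes the increment of h. *)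
Lemma circle_fun_segment m (p : plot X m) (x v : 'rV[R]_m) :
  circle_fun h (p (x + v)) = circle_fun h (p x) + expi (segment_integral p x v).
Proof.
pose q := plot_comp p (smooth_segment x v).
pose s : simplex X 1 := Simplex (ex_intro
  (fun q' : plot X 2 => forall y, q (sval y) = q' (sval y)) q (fun _ => erefl)).
have sq y : s y = q (sval y) by [].
have := hw << s >>; rewrite (bd_simplex1 sq) hm /int_chain lin_extU.
have qE t : q (bary (const_mx t)) = p (x + t *: v) by rewrite /= bary1 mxE.
rewrite !qE scale1r scale0r addr0 => /(canRL (subrK _)).
rewrite -/(circle_fun h (p (x + v))) -/(circle_fun h (p x)) => ->; rewrite addrC.
congr (_ + expi _); rewrite (int_simplexE fw sq) simplex_integral1.
apply: eq_Rintegral => t _; rewrite delta_mx1.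
have sg : smooth (fun y : 'rV[R]_1 => x + y 0 0 *: v).
  move=> k; apply: times_diffD; first exact: times_diff_cst.
  by apply: times_diffZ; exact: smooth_coord.
have -> : plot_comp q (@smooth_bary R 1) = plot_comp p sg.
  apply: plot_eq => y /=; congr (p (_ + _ *: _)).
  have {1}-> : y = const_mx (y 0 0) by apply/rowP => j; rewrite mxE ord1.
  by rewrite bary1 mxE.
rewrite (form_natural fw) mxE; congr (w _ _ _); apply/funext => _.
by apply: derive_affine => r; rewrite !mxE mulr1 scalerDl addrCA.
Qed.

(** By [circle_fun_segment], h near a point of a plot is its value at that point
rotated by a differentiable angle, which gives its first derivative as a product
of h and the smooth form w.  Differentiability of every order follows by induction, real and
imaginary parts together since each occurs in the derivative of the other. *)
Lemma smooth_of_curv : circle_smooth (fun x : X => h (point_cyc x)).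
Proof.
move=> m p.
suff H : forall k, times_diff k (re_along h p) /\ times_diff k (im_along h p).
  by split=> k; have [] := H k.
pose L x v := 2 * pi * form_at p x v.
have dE x : (differentiable (re_along h p) x /\ differentiable (im_along h p) x) /\
    (forall v, 'D_v (re_along h p) x = - 1 * (im_along h p x * L x v) /\
               'D_v (im_along h p) x = re_along h p x * L x v).
  have [dF DF] := segment_integral_diff p x; set F := fun y => _ in dF DF.
  have F0 : F x = 0 by rewrite /F subrr segment_integral0.
  have zE y : circle_fun h (p y) = circle_fun h (p x) + expi (F y).
    by rewrite -circle_fun_segment subrKC.
  pose a := re_along h p x; pose b := im_along h p x.
  have rE : re_along h p = (fun s => a * cos (2 * pi * s) + - b * sin (2 * pi * s)) \o F.
    by apply/funext => y; rewrite /re_along zE Re_circleD /= mulNr.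
  have iE : im_along h p = (fun s => b * cos (2 * pi * s) + a * sin (2 * pi * s)) \o F.
    by apply/funext => y; rewrite /im_along zE Im_circleD /= addrC.
  have dr := is_derive_rotation a (- b); have di := is_derive_rotation b a.
  rewrite -F0 in dr di.
  split; first by split; [rewrite rE|rewrite iE]; have [] := derive_comp_real 0 dF dr;
    have [] := derive_comp_real 0 dF di.
  move=> v; have [_ Dr] := derive_comp_real v dF dr; have [_ Di] := derive_comp_real v dF di.
  rewrite {1}rE {2}iE Dr Di DF /L; split; rewrite -/a -/b; ring.
have sL v : smooth (L ^~ v).
  by move=> k; apply: times_diffM; [exact: times_diff_cst|exact: (form_smooth fw)].
elim=> [//|k [IHr IHi]]; split; split=> [x|v].
- by have [[]] := dE x.
- rewrite (_ : (fun x => _) = fun x => - 1 * (im_along h p x * L x v)).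
    apply: times_diffM; first exact: times_diff_cst.
    by apply: times_diffM => //; exact: sL.
  by apply/funext => x; have [_ /(_ v)[]] := dE x.
- by have [[]] := dE x.
- rewrite (_ : (fun x => _) = fun x => re_along h p x * L x v).
    by apply: times_diffM => //; exact: sL.
  by apply/funext => x; have [_ /(_ v)[]] := dE x.
Qed.

End SmoothFromCurvature.

(** * Trivializations along a smooth map *)

Section Characters.
Context {R : realType}.
Implicit Types X Y A : @smoothSpace R.

(** Only degree 1 has content: there a smooth function is traded for its
logarithmic derivative, and recovered from it. *)
Lemma dcharP X m (h : cyc X m -> circle R) :
  dchar (n := m.+1) h <->
  zmod_morphism h /\ exists w : rform X m.+1 R, is_form w /\ has_curv (n := m.+1) h w.
Proof.
case: m h => [|m] h; last by [].
split=> [[hm hs]|[hm [w [fw hw]]]].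
  split=> //; exists (dlog h); split; [exact: dlog_is_form|exact: dlog_curv].
by split=> //; exact: smooth_of_curv hw.
Qed.

Lemma dchar_subgroup X m : is_subgroup (@dchar R X m.+1).
Proof.
split.
  apply/dcharP; split; first by move=> z z'; rewrite subrr.
  exists (zero_form R); split; first exact: zero_form_is_form.
  by move=> c; rewrite int_chain0 expi0.
move=> h h' /dcharP[hm [w [fw hw]]] /dcharP[hm' [w' [fw' hw']]].
apply/dcharP; split.
  by move=> z z'; rewrite !fctE hm hm' !opprD !opprK addrACA.
exists (sub_form w w'); split; first exact: sub_form_is_form.
by move=> c; rewrite int_chainB// expiB !fctE hw hw'.
Qed.

Lemma push_cyc_bd X Y (f : smap Y X) n (c : schain Y n) :
  push_cyc f (bd_cyc c) = bd_cyc (push_chain f c).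
Proof. by apply/val_inj; rewrite /= bd_push. Qed.

Lemma zmod_morphism0 (U V : zmodType) (g : U -> V) : zmod_morphism g -> g 0 = 0.
Proof. by move=> gB; rewrite -(subrr 0) gB subrr. Qed.

Lemma push_cycB X Y (f : smap Y X) n (z z' : cyc Y n) :
  push_cyc f (z - z') = push_cyc f z - push_cyc f z'.
Proof. by apply/val_inj; rewrite /= raddfB. Qed.

Lemma pull_dchar_dchar X Y (f : smap Y X) m (h : cyc X m -> circle R) :
  dchar (n := m.+1) h -> dchar (n := m.+1) (pull_dchar f h).
Proof.
move=> /dcharP[hm [w [fw hw]]]; apply/dcharP; split.
  by move=> z z'; rewrite /pull_dchar push_cycB hm.
exists (pull_form f w); split; first exact: pull_form_is_form.
by move=> c; rewrite /pull_dchar (@push_cyc_bd _ _ f m.+1) hw int_chain_push.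
Qed.

Variables (A X : @smoothSpace R) (f : smap A X) (m : nat).
Variable c0 : rcyc f m.+1 -> circle R.

(** For the projection f of a principal bundle and its Cheeger-Chern-Simons
character c0 this is the set of differential trivializations. *)
Definition trivializations : set (cyc A m -> circle R) :=
  [set q | @dchar R A m.+1 q /\ exists rho : rform X m.+1 R, is_form rho /\
      - @ibreve_char R A X f m.+2 q = c0 - @iota_char R A X f m.+2 rho (zero_form R)].

Lemma trivializationsP q : trivializations q <->
  @dchar R A m.+1 q /\ exists rho : rform X m.+1 R, is_form rho /\
    forall z : rcyc f m.+1, q (rcyc_snd z) = expi (int_chain rho (val z).1) - c0 z.
Proof.
have E rho (z : rcyc f m.+1) :
    @iota_char R A X f m.+2 rho (zero_form R) z = expi (int_chain rho (val z).1).
  by rewrite /iota_char int_chain0 addr0.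
split=> -[qA [rho [frho qE]]]; split=> //; exists rho; split=> //.
  move=> z; have /(congr1 (fun F => - F z)) := qE.
  by rewrite !fctE E opprK opprB /ibreve_char.
apply/funext => z; rewrite !fctE E /ibreve_char.
by have := qE z; rewrite /= => ->; rewrite opprB.
Qed.

(** On a relative cycle (s, t) the push-forward of t is the boundary of - s. *)
Lemma pull_dchar_snd (h : cyc X m -> circle R) (w : rform X m.+1 R) (z : rcyc f m.+1) :
  zmod_morphism h -> has_curv (n := m.+1) h w ->
  pull_dchar f h (rcyc_snd z) = - expi (int_chain w (val z).1).
Proof.
move=> hm hw; rewrite /pull_dchar.
have -> : push_cyc f (rcyc_snd z) = bd_cyc (- (val z).1 : schain X m.+1).
  apply/val_inj; rewrite /= raddfN; have /(congr1 fst) /= := ker_ofE z.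
  by move/eqP; rewrite addrC addr_eq0 => /eqP.
by rewrite hw -[- _]sub0r int_chain_morphism (zmod_morphism0 (int_chain_morphism w)) sub0r expiN.
Qed.

Lemma trivializations_act (q : cyc A m -> circle R) (h : cyc X m -> circle R) :
  trivializations q -> @dchar R X m.+1 h -> trivializations (q + pull_dchar f h).
Proof.
move=> /trivializationsP[qA [rho [frho qE]]] hX; apply/trivializationsP; split.
  have [d0 dB] := dchar_subgroup A m.
  rewrite -[pull_dchar f h]opprK; apply: (dB) => //.
  rewrite -sub0r; apply: (dB) => //; exact: pull_dchar_dchar.
have /dcharP[hm [w [fw hw]]] := hX.
exists (sub_form rho w); split; first exact: sub_form_is_form.
move=> z; rewrite !fctE (pull_dchar_snd _ hm hw) qE int_chainB// expiB.
by rewrite addrAC.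
Qed.

(** The character h is prescribed on f_* Z(A) + B(X), where the two
trivializations leave no choice, and extended by divisibility of U(1). *)
Lemma trivializations_transitive q q' : trivializations q -> trivializations q' ->
  exists2 h, @dchar R X m.+1 h & q + pull_dchar f h = q'.
Proof.
move=> /trivializationsP[qA [rho [frho qE]]] /trivializationsP[q'A [rho' [frho' q'E]]].
have [_ dcharB] := dchar_subgroup A m.
have /dcharP[dm _] : @dchar R A m.+1 (q' - q) by exact: dcharB.
set d := q' - q in dm.
pose nu := sub_form rho rho'.
have fnu : is_form nu by exact: sub_form_is_form.
have dE (z : rcyc f m.+1) : d (rcyc_snd z) = - expi (int_chain nu (val z).1).
  rewrite /d !fctE qE q'E int_chainB// expiB !opprB.
  by rewrite addrA subrK.
pose M : set (cyc X m * circle R) := [set p | exists (t : cyc A m) (s : schain X m.+1),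
  p = (push_cyc f t + bd_cyc s, d t + expi (int_chain nu s))].
have push_cyc0 := zmod_morphism0 (@push_cycB X A f m).
have bd_cyc0 := zmod_morphism0 (@bd_cycB R X m.+1).
have gM : subgraph M.
  split.
  - exists 0, 0; rewrite push_cyc0 bd_cyc0 !(zmod_morphism0 dm) addr0.
    by rewrite (zmod_morphism0 (int_chain_morphism nu)) expi0 addr0.
  - move=> p p' [t [s ->]] [t' [s' ->]]; exists (t - t'), (s - s').
    rewrite push_cycB bd_cycB dm int_chain_morphism expiB pairB.
    by congr pair; rewrite opprD addrACA.
  - move=> e [t [s [E ->]]].
    (* If f_* t + bd s = 0 then (s, t) is a relative cycle, and dE applies. *)
    have zP : rbd f (n := m.+1) ((s, val t) : rchain A X m.+1) = 0.
      rewrite /rbd /= (_ : bd (val t) = 0) ?oppr0; last exact: ker_ofE.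
      by congr pair; exact: etrans (addrC _ _) (esym E).
    pose z : rcyc f m.+1 := in_kerP zP.
    have := dE z; rewrite (_ : rcyc_snd z = t) => [->|]; last exact/val_inj.
    by rewrite addNr.
have [h hm hM] := extend_hom (@circle_divisible R) gM.
exists h.
  apply/dcharP; split=> //; exists nu; split=> // s.
  apply: hM; exists 0, s.
  by rewrite push_cyc0 (zmod_morphism0 dm) !add0r.
rewrite (_ : pull_dchar f h = d); first by rewrite /d subrKC.
apply/funext => t; apply: hM; exists t, 0.
by rewrite bd_cyc0 (zmod_morphism0 (int_chain_morphism nu)) expi0 !addr0.
Qed.

End Characters.

Theorem proposition4p4 (R : realType) (G : lieGroup R)
  (hG : finitely_many_components G) (E : universalBundle G)
  (k : nat) (hk : (0 < k)%N)
  (lam : ('I_k -> lie_alg G) -> R) (u : cohomology (BG E) k.*2 int)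
  (hu : K_group lam u)
  (X : @smoothSpace R) (hX : manifold X) (P : principalBundle G X)
  (theta : rform P 1 (lie_alg G)) (htheta : is_connection theta)
  (ccs : rcyc (bundle_proj P) (k.*2).-1 -> circle R) (hccs : is_CCS lam u theta ccs) :
  let T := diff_trivializations ccs in
  let HX := @dchar R X (k.*2).-1 in
  let HP := @dchar R P (k.*2).-1 in
  let pull := @pull_dchar R X P (bundle_proj P) (k.*2).-1.-1 in
  [/\ is_group_action HX T (fun q h => q + pull h),
      [set pull h | h in HX] `<=` HP
    & is_torsor [set pull h | h in HX] T (fun q a => q + a)].
Proof.
clear - hk ccs; case: k hk ccs => [//|k] _ ccs T HX HP pull.
have [X0 XB] := dchar_subgroup X k.*2.
have pullB h h' : pull (h - h') = pull h - pull h' by [].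
split.
- split.
  + exact: dchar_subgroup.
  + by move=> q h; exact: trivializations_act.
  + by move=> q _; exact: addr0.
  + by move=> q h h' _ _ _; exact: addrA.
- by move=> _ [h hX <-]; exact: pull_dchar_dchar.
- split.
  + split.
    * split; first by exists 0.
      by move=> _ _ [h hX <-] [h' hX' <-]; exists (h - h') => //; exact: XB.
    * by move=> q _ Tq [h hX <-]; exact: trivializations_act.
    * by move=> q _; exact: addr0.
    * by move=> q a b _ _ _; exact: addrA.
  + by move=> q a _ _ /eqP; rewrite -subr_eq0 addrAC subrr add0r => /eqP.
  + move=> q q' Tq Tq'; have [h hX qh] := trivializations_transitive Tq Tq'.
    by exists (pull h) => //; exists h.
Qed.
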